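(* Let $\mu$ be a Borel probability measure on $\mathbb{R}$ that is singular to the Lebesgue measure $\lambda$ and has zero mean and unit variance. Let $T_\mu$ be the $\lambda$-preserving transformation of $\mathbb{R}$ given by the boundary values of the $F$-transform of $\mu$, and let $a_n(T_\mu)$ be its return sequence. Then $$a_{n}(T_{\mu})\sim\frac{\sqrt{2n}}{\pi}\qquad(n\to\infty).$$
   Context: $\mathbb{C}^{+}=\{x+iy:y>0\}$. The $F$-transform of a Borel probability measure $\mu$ on $\mathbb{R}$ is the analytic map $F_\mu:\mathbb{C}^+\to\mathbb{C}^+$ defined by $\frac{1}{F_{\mu}(z)}=\int_{\mathbb{R}}\frac{1}{z-t}\,d\mu(t)$. When $\mu$ is singular to Lebesgue measure $\lambda$, the limit $T_\mu x=\lim_{y\to0^+}F_\mu(x+iy)$ exists in $\mathbb{R}$ for $\lambda$-a.e. $x\in\mathbb{R}$, and $T_\mu$ preserves $\lambda$, i.e. $\lambda\circ T_\mu^{-1}=\lambda$ on the Borel $\sigma$-field. The Perron-Frobenius operator $\widehat{T_\mu}:L_1(\lambda)\to L_1(\lambda)$ is defined by $\int_{\mathbb{R}}\widehat{T_{\mu}}f\cdot g\,d\lambda=\int_{\mathbb{R}}f\cdot (g\circ T_{\mu})\,d\lambda$ for $f\in L_1(\lambda)$, $g\in L_\infty(\lambda)$. A return sequence of $T_\mu$ is a sequence of constants $a_n(T_\mu)>0$ such that for every $f\in L_1(\lambda)$, $\frac{1}{a_{n}(T_{\mu})}\sum_{k=0}^{n-1}\widehat{T_{\mu}}^{k}f\to\int_{\mathbb{R}}f\,d\lambda$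 $\lambda$-a.e. as $n\to\infty$. Under the stated hypotheses a return sequence exists (Aaronson) and it is unique up to asymptotic equivalence. The notation $a_n\sim b_n$ means $a_n/b_n\to1$. *)

(* Defs.v *)
From HB Require Import structures.
From mathcomp Require Import all_boot all_order all_algebra.
From mathcomp Require Import all_classical all_reals all_analysis.
From mathcomp Require Import complex.

Set Implicit Arguments.
Unset Strict Implicit.
Unset Printing Implicit Defensive.

Import Order.TTheory GRing.Theory Num.Theory.
Import numFieldNormedType.Exports.

Local Open Scope classical_set_scope.
Local Open Scope complex_scope.
Local Open Scope ring_scope.

Definition mutually_singular d (T : measurableType d) (R : realType)
    (mu nu : {measure set T -> \bar R}) : Prop :=
  exists N : set T,
    [/\ measurable N, mu (~` N) = 0%E & nu N = 0%E].

Definition cintegral d (T : measurableType d) (R : realType)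
    (mu : {measure set T -> \bar R}) (f : T -> R[i]) : R[i] :=
  (\int[mu]_t complex.Re (f t)) +i* (\int[mu]_t complex.Im (f t)).

(* Only meaningful for z in the upper half-plane; there the integral is
   nonzero, so the inversion does not meet the convention 0^-1 = 0. *)
Definition F_transform (R : realType) (mu : probability (measurableTypeR R) R)
    (z : R[i]) : R[i] :=
  (cintegral mu (fun t : R => (z - t%:C)^-1))^-1.

(* The boundary values exist only almost everywhere, so T_mu is determined up
   to a null set; this says that T is a measurable version of it. *)
Definition is_boundary_map (R : realType)
    (mu : probability (measurableTypeR R) R) (T : R -> R) : Prop :=
  measurable_fun [set: measurableTypeR R] (T : _ -> measurableTypeR R) /\
  {ae lebesgue_measure, forall x : R,
    F_transform mu (x +i* y) @[y --> 0^'+] --> ((T x)%:C : R[i]^o)}.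

(* Elements of L_1 are represented by functions; the dual condition determines
   the image up to a null set, and a representative of it is chosen. *)
Definition perron_frobenius (R : realType) (T : R -> R) (f : R -> R) : R -> R :=
  xget (cst 0) [set h : R -> R |
    h \in Lfun (@lebesgue_measure R) 1%E /\
    forall g : R -> R, g \in Lfun (@lebesgue_measure R) +oo%E ->
      \int[lebesgue_measure]_x (h x * g x) =
      \int[lebesgue_measure]_x (f x * g (T x))].

Definition is_return_sequence (R : realType) (T : R -> R) (a : R^nat) : Prop :=
  (forall n, 0 < a n) /\
  forall f : R -> R, f \in Lfun (@lebesgue_measure R) 1%E ->
    {ae lebesgue_measure, forall x : R,
      (a n)^-1 * \sum_(0 <= k < n) iter k (perron_frobenius T) f x
        @[n --> \oo] --> \int[lebesgue_measure]_t f t}.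

(* a_n / b_n --> 1 (the value of x / 0 = 0 at finitely many n is irrelevant) *)
Definition seq_equivalent (R : realType) (a b : R^nat) : Prop :=
  a n / b n @[n --> \oo] --> (1 : R).

(* Main.v *)
(* Fix z in the upper half-plane. Its Poisson kernel is a Cauchy density. For
   Im a < 0 the resolvent w |-> 1 / (F w - a) is bounded and analytic, so
   Poisson's formula expresses its value at z by its boundary values
   1 / (T t - a). Hence T pushes the Cauchy law of z to that of F z, i.e. the
   Perron-Frobenius operator sends the Poisson kernel of z to that of F z.
   Finite variance gives F z ^ 2 = z ^ 2 - 2 + o(1) as z goes to infinity in the
   cone |Re z| <= Im z. The orbit z_k of a point high on the imaginary axis
   therefore satisfies z_k ^ 2 ~ - 2 k, and the Poisson kernels of z_0, ...,
   z_(n-1) sum to an equivalent of sqrt (2 n) / pi at every real point; the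
   return sequence is read off from the kernel of z_0, which has integral 1.
   In place of complex function theory, analyticity enters as uniform
   approximation by polynomials in a Cayley transform. *)

From HB Require Import structures.
Require Import Defs.
From mathcomp Require Import all_boot all_order all_algebra.
From mathcomp Require Import all_classical all_reals all_analysis.
From mathcomp Require Import measurable_realfun ess_sup_inf complex ring lra.

Import Order.TTheory GRing.Theory Num.Theory.
Import numFieldNormedType.Exports.

Local Open Scope classical_set_scope.
Local Open Scope complex_scope.
Local Open Scope ring_scope.

Local Notation Re := complex.Re.
Local Notation Im := complex.Im.

Set Implicit Arguments.
Unset Strict Implicit.
Unset Printing Implicit Defensive.

(** * Complex-valued integrals *)

(** Resolvents are the right test functions for two reasons: with pole [a] in the lower half-plane
    they are bounded above the real axis, and on it their imaginary parts are, for the pole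
    [conjc w], Poisson kernels up to the factor [- pi^-1] ([poissonE]); such kernels determine a law
    by Stieltjes inversion. The obstacle is that F has boundary values only almost everywhere, while
    uniform approximation by polynomials needs a function on the closed half-plane. Poisson's
    formula is therefore proved for F shifted upwards by [e], and [e] is sent to 0 by dominated
    convergence. Approximability passes through sums, products, uniform limits and geometric series;
    it enters with [1 / F], which is an average of simple fractions. The orbit is followed through
    the squares [z ^+ 2], because F acts on them almost as the translation by -2; they decrease so
    steadily in real part that the orbit never leaves the cone. Since [perron_frobenius] is a chosen
    representative, its iterates are Poisson kernels only almost everywhere. Countably many null
    sets are discarded, and one remaining real point decides the asymptotics. *)

Section complex_facts.
Context {R : realType}.
Implicit Types (z w : R[i]) (x y : R).

Lemma ReD z w : Re (z + w) = Re z + Re w. Proof. by case: z; case: w. Qed.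
Lemma ImD z w : Im (z + w) = Im z + Im w. Proof. by case: z; case: w. Qed.
Lemma ReN z : Re (- z) = - Re z. Proof. by case: z. Qed.
Lemma ImN z : Im (- z) = - Im z. Proof. by case: z. Qed.
Lemma ReB z w : Re (z - w) = Re z - Re w. Proof. by rewrite ReD ReN. Qed.
Lemma ImB z w : Im (z - w) = Im z - Im w. Proof. by rewrite ImD ImN. Qed.
Lemma ReM z w : Re (z * w) = Re z * Re w - Im z * Im w.
Proof. by case: z; case: w. Qed.
Lemma ImM z w : Im (z * w) = Re z * Im w + Im z * Re w.
Proof. by case: z; case: w. Qed.
Lemma ReV z : Re z^-1 = Re z * (Re z ^+ 2 + Im z ^+ 2)^-1.
Proof. by case: z. Qed.
Lemma ImV z : Im z^-1 = - Im z * (Re z ^+ 2 + Im z ^+ 2)^-1.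
Proof. by case: z => a b; rewrite /= mulNr. Qed.

Lemma complexP z w : Re z = Re w -> Im z = Im w -> z = w.
Proof. by case: z => a b; case: w => c d /= -> ->. Qed.

Lemma ler_normRe z : `|Re z|%:C <= `|z|. Proof. exact: normc_ge_Re. Qed.

Lemma ler_normIm z : `|Im z|%:C <= `|z|.
Proof.
by rewrite normc_def lecR -sqrtr_sqr ler_wsqrtr// lerDr sqr_ge0.
Qed.

Lemma ler_normc_add z : `|z| <= (`|Re z| + `|Im z|)%:C.
Proof.
rewrite normc_def lecR -[leRHS]ger0_norm ?addr_ge0// -sqrtr_sqr ler_wsqrtr//.
by rewrite sqrrD !real_normK ?num_real// lerD2r lerDl mulrn_wge0// mulr_ge0.
Qed.

Lemma normcR x : `|x%:C| = `|x|%:C.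
Proof. by rewrite normc_def /= expr0n addr0 sqrtr_sqr. Qed.

Lemma realcM x y : (x * y)%:C = x%:C * y%:C :> R[i].
Proof. exact: rmorphM. Qed.

Lemma realcD x y : (x + y)%:C = x%:C + y%:C :> R[i].
Proof. exact: rmorphD. Qed.

Lemma realcD_Im x y : x%:C + 0 +i* y = x +i* y :> R[i].
Proof. by apply: complexP; rewrite ?ReD ?ImD /= ?addr0 ?add0r. Qed.

Lemma Im_neq0 z : Im z != 0 -> z != 0.
Proof. by apply: contra => /eqP ->. Qed.

Lemma ler_normV_Im z y : 0 < y -> y <= `|Im z| -> `|z^-1| <= y^-1%:C.
Proof.
move=> y0 yz; rewrite normfV.
have yz' : y%:C <= `|z| by rewrite (le_trans _ (ler_normIm z))// lecR.
have y0' : 0 < y%:C by rewrite ltcR.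
by rewrite fmorphV lef_pV2 ?posrE// (lt_le_trans y0').
Qed.

End complex_facts.

Section complex_measurable.
Context {d} {T : measurableType d} {R : realType}.
Implicit Types f g : T -> R[i].

Definition cmeasurable f :=
  measurable_fun [set: T] (fun t => Re (f t)) /\
  measurable_fun [set: T] (fun t => Im (f t)).

Lemma cmeasurable_cst z : cmeasurable (fun=> z).
Proof. by split; exact: measurable_cst. Qed.

Lemma cmeasurableD f g : cmeasurable f -> cmeasurable g ->
  cmeasurable (fun t => f t + g t).
Proof.
move=> [f1 f2] [g1 g2]; split.
  by under eq_fun do rewrite ReD; exact: measurable_funD.
by under eq_fun do rewrite ImD; exact: measurable_funD.
Qed.

Lemma cmeasurableM f g : cmeasurable f -> cmeasurable g ->
  cmeasurable (fun t => f t * g t).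
Proof.
move=> [f1 f2] [g1 g2]; split.
  by under eq_fun do rewrite ReM; apply: measurable_funB; exact: measurable_funM.
by under eq_fun do rewrite ImM; apply: measurable_funD; exact: measurable_funM.
Qed.

Lemma cmeasurableN f : cmeasurable f -> cmeasurable (fun t => - f t).
Proof.
move=> mf; under eq_fun do rewrite -mulN1r.
by apply: cmeasurableM => //; exact: cmeasurable_cst.
Qed.

Lemma cmeasurableB f g : cmeasurable f -> cmeasurable g ->
  cmeasurable (fun t => f t - g t).
Proof. by move=> mf mg; apply: cmeasurableD => //; exact: cmeasurableN. Qed.

Lemma cmeasurableX f n : cmeasurable f -> cmeasurable (fun t => f t ^+ n).
Proof.
move=> mf; elim: n => [|n IH].
  by under eq_fun do rewrite expr0; exact: cmeasurable_cst.
by under eq_fun do rewrite exprS; exact: cmeasurableM.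
Qed.

Lemma cmeasurableV f : cmeasurable f -> cmeasurable (fun t => (f t)^-1).
Proof.
move=> [f1 f2].
have mV : measurable_fun [set: T] (fun t => (Re (f t) ^+ 2 + Im (f t) ^+ 2)^-1).
  (* For a nonnegative base, 0 included, the inverse is the real power with exponent -1, and real
     powers are measurable. *)
  under eq_fun do rewrite -powR_inv1 ?addr_ge0 ?sqr_ge0//.
  apply: (measurableT_comp (measurable_powR _)) => //.
  by apply: measurable_funD; exact: measurable_funX.
split.
  by under eq_fun do rewrite ReV; exact: measurable_funM.
under eq_fun do rewrite ImV; apply: measurable_funM => //.
exact: (measurable_funN f2).
Qed.

Lemma cmeasurableC (f : T -> R) : measurable_fun [set: T] f ->
  cmeasurable (fun t => (f t)%:C).
Proof. by move=> mf; split => //; exact: measurable_cst. Qed.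

Lemma cmeasurable_horner (P : {poly R[i]}) f : cmeasurable f ->
  cmeasurable (fun t => P.[f t]).
Proof.
move=> mf; elim/poly_ind: P => [|P c IH].
  by under eq_fun do rewrite horner0; exact: cmeasurable_cst.
under eq_fun do rewrite hornerMXaddC.
by apply: cmeasurableD; [exact: cmeasurableM|exact: cmeasurable_cst].
Qed.

End complex_measurable.

Section cintegral_facts.
Context {d} {T : measurableType d} {R : realType}.
Variable mu : {measure set T -> \bar R}.
Implicit Types f g : T -> R[i].

Definition cintegrable f :=
  mu.-integrable [set: T] (fun t => (Re (f t))%:E) /\
  mu.-integrable [set: T] (fun t => (Im (f t))%:E).

Lemma le_cintegrable f (g : T -> R) : cmeasurable f ->
  mu.-integrable [set: T] (EFin \o g) ->
  (forall t, `|f t| <= (g t)%:C) -> cintegrable f.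
Proof.
move=> [mf1 mf2] ig fg.
have g0 t : 0 <= g t by rewrite -ler0c (le_trans _ (fg t)).
split; apply: (le_integrable _ _ _ ig) => //=.
- exact/measurable_EFinP.
- by move=> t _; rewrite lee_fin (ger0_norm (g0 t)) -lecR (le_trans (ler_normRe _)).
- exact/measurable_EFinP.
- by move=> t _; rewrite lee_fin (ger0_norm (g0 t)) -lecR (le_trans (ler_normIm _)).
Qed.

Lemma cintegralD f g : cintegrable f -> cintegrable g ->
  cintegral mu (fun t => f t + g t) = cintegral mu f + cintegral mu g.
Proof.
move=> [f1 f2] [g1 g2]; apply: complexP => /=.
  by under eq_Rintegral do rewrite ReD; rewrite RintegralD.
by under eq_Rintegral do rewrite ImD; rewrite RintegralD.
Qed.

Lemma cintegrableD f g : cintegrable f -> cintegrable g ->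
  cintegrable (fun t => f t + g t).
Proof.
move=> [f1 f2] [g1 g2]; split.
  by under eq_fun do rewrite ReD EFinD; exact: integrableD.
by under eq_fun do rewrite ImD EFinD; exact: integrableD.
Qed.

Lemma cintegrableZl z f : cintegrable f -> cintegrable (fun t => z * f t).
Proof.
move=> [f1 f2]; split.
  under eq_fun do rewrite ReM EFinB !EFinM.
  by apply: integrableB => //; exact: integrableZl.
under eq_fun do rewrite ImM EFinD !EFinM.
by apply: integrableD => //; exact: integrableZl.
Qed.

Lemma cintegralZl z f : cintegrable f ->
  cintegral mu (fun t => z * f t) = z * cintegral mu f.
Proof.
have iZ (r : R) (h : T -> R) : mu.-integrable [set: T] (EFin \o h) ->
    mu.-integrable [set: T] (EFin \o (fun t => r * h t)).
  move=> ih; rewrite /comp; under eq_fun do rewrite EFinM.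
  exact: integrableZl.
move=> [f1 f2]; apply: complexP; rewrite ?ReM ?ImM /=.
  under eq_Rintegral do rewrite ReM.
  by rewrite RintegralB ?RintegralZl//; exact: iZ.
under eq_Rintegral do rewrite ImM.
by rewrite RintegralD ?RintegralZl//; exact: iZ.
Qed.

Lemma cintegralB f g : cintegrable f -> cintegrable g ->
  cintegral mu (fun t => f t - g t) = cintegral mu f - cintegral mu g.
Proof.
move=> cf cg; under eq_fun do rewrite -mulN1r.
by rewrite cintegralD ?cintegralZl ?mulN1r//; exact: cintegrableZl.
Qed.

Lemma cintegrable0 : cintegrable (fun=> 0).
Proof. by split => /=; exact: integrable0. Qed.

Lemma cintegral0 : cintegral mu (fun=> 0) = 0.
Proof. by apply: complexP; rewrite /= /Rintegral integral0. Qed.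

Lemma cintegrable_sum (f : nat -> T -> R[i]) n :
  (forall k, cintegrable (f k)) -> cintegrable (fun t => \sum_(k < n) f k t).
Proof.
move=> cf; elim: n => [|n IH].
  by under eq_fun do rewrite big_ord0; exact: cintegrable0.
by under eq_fun do rewrite big_ord_recr /=; exact: cintegrableD.
Qed.

Lemma cintegral_sum (f : nat -> T -> R[i]) n : (forall k, cintegrable (f k)) ->
  cintegral mu (fun t => \sum_(k < n) f k t) = \sum_(k < n) cintegral mu (f k).
Proof.
move=> cf; elim: n => [|n IH].
  by under eq_fun do rewrite big_ord0; rewrite big_ord0 cintegral0.
under eq_fun do rewrite big_ord_recr /=.
by rewrite big_ord_recr/= cintegralD ?IH//; exact: cintegrable_sum.
Qed.

(** Real and imaginary parts are bounded separately, whence the factor 2. It is harmless: every use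
    is a limit argument or a bound up to a constant. *)
Lemma ler_norm_cintegral f (g : T -> R) : cmeasurable f ->
  mu.-integrable [set: T] (EFin \o g) ->
  (forall t, `|f t| <= (g t)%:C) ->
  `|cintegral mu f| <= (2 * \int[mu]_t g t)%:C.
Proof.
move=> mf ig fg; have [i1 i2] := le_cintegrable mf ig fg.
apply: (le_trans (ler_normc_add _)); rewrite lecR mulr_natl mulr2n lerD//=.
- apply: (le_trans (le_normr_Rintegral _ i1)) => //.
  apply: le_Rintegral => //; first exact: (integrable_norm i1).
  by move=> t _; rewrite -lecR (le_trans (ler_normRe _)).
- apply: (le_trans (le_normr_Rintegral _ i2)) => //.
  apply: le_Rintegral => //; first exact: (integrable_norm i2).
  by move=> t _; rewrite -lecR (le_trans (ler_normIm _)).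
Qed.

End cintegral_facts.

(** * Bounded analytic functions on the upper half-plane *)

Section disc_algebra.
Context {R : realType}.
Implicit Types (z w a : R[i]) (h q : R[i] -> R[i]).

Definition cayley z w := (w - z) / (w - conjc z).

Lemma ler_normc_sqr z w :
  (Re z) ^+ 2 + (Im z) ^+ 2 <= (Re w) ^+ 2 + (Im w) ^+ 2 -> `|z| <= `|w|.
Proof. by move=> zw; rewrite !normc_def lecR ler_wsqrtr. Qed.

Lemma Im_conjc z : Im (conjc z) = - Im z. Proof. by case: z. Qed.
Lemma Re_conjc z : Re (conjc z) = Re z. Proof. by case: z. Qed.

Lemma sub_conjc_neq0 z w : 0 < Im z -> 0 <= Im w -> w - conjc z != 0.
Proof.
move=> z0 w0; apply: Im_neq0; rewrite ImB Im_conjc opprK.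
by rewrite gt_eqF// ltr_wpDl.
Qed.

(** A point of the upper half-plane is nearer to [z] than to its mirror image: the two squared
    distances differ by [4 * Im z * Im w]. *)
Lemma norm_cayley_le1 z w : 0 < Im z -> 0 <= Im w -> `|cayley z w| <= 1.
Proof.
move=> z0 w0; rewrite normrM normfV ler_pdivrMr ?normr_gt0 ?sub_conjc_neq0//.
rewrite mul1r; apply: ler_normc_sqr; rewrite !ReB !ImB Re_conjc Im_conjc.
nra.
Qed.

Lemma cayleyxx z : cayley z z = 0.
Proof. by rewrite /cayley subrr mul0r. Qed.

(* The disc algebra transported to the closed upper half-plane by the Cayley
   transform that sends [z] to [0]. *)
Definition disc_alg z h := forall e : R, 0 < e -> exists P : {poly R[i]},
  forall w, 0 <= Im w -> `|h w - P.[cayley z w]| <= e%:C.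

Lemma disc_alg_cst z c : disc_alg z (fun=> c).
Proof.
move=> e e0; exists c%:P => w _; rewrite hornerC subrr normr0.
by rewrite lecR ltW.
Qed.

Lemma disc_alg_ulim z h :
  (forall e : R, 0 < e -> exists2 g, disc_alg z g &
     forall w, 0 <= Im w -> `|h w - g w| <= e%:C) ->
  disc_alg z h.
Proof.
move=> hg e e0; have e20 : 0 < e / 2 by rewrite divr_gt0.
have [g /(_ _ e20)[P gP] hgw] := hg _ e20.
exists P => w w0; rewrite -(subrKA (g w)) (le_trans (ler_normD _ _))//.
by rewrite [e in leRHS]splitr rmorphD lerD ?hgw ?gP.
Qed.

Lemma disc_algD z h q : disc_alg z h -> disc_alg z q ->
  disc_alg z (fun w => h w + q w).
Proof.
move=> hP qP e e0; have e20 : 0 < e / 2 by rewrite divr_gt0.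
have [P {}hP] := hP _ e20; have [Q {}qP] := qP _ e20.
exists (P + Q) => w w0; rewrite hornerD opprD addrACA.
rewrite (le_trans (ler_normD _ _))//.
by rewrite [e in leRHS]splitr rmorphD lerD ?hP ?qP.
Qed.

Lemma disc_algM z h q (M : R) : 0 < M ->
  (forall w : R[i], 0 <= Im w -> `|h w| <= M%:C) ->
  (forall w : R[i], 0 <= Im w -> `|q w| <= M%:C) ->
  disc_alg z h -> disc_alg z q -> disc_alg z (fun w => h w * q w).
Proof.
move=> M0 hM qM hP qP e e0.
have e20 : 0 < e / 2 by rewrite divr_gt0.
have [Q {}qP] := qP _ (divr_gt0 e20 M0).
(* [P] is chosen after [Q], because its tolerance depends on the bound [M + e / 2 / M] that [Q]
   inherits from [q]. *)
have M'0 : 0 < M + e / 2 / M by rewrite addr_gt0 ?divr_gt0.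
have [P {}hP] := hP _ (divr_gt0 e20 M'0).
exists (P * Q) => w w0; rewrite hornerM.
set u := cayley z w.
have -> : h w * q w - P.[u] * Q.[u] =
    h w * (q w - Q.[u]) + (h w - P.[u]) * Q.[u] by ring.
have Qb : `|Q.[u]| <= (M + e / 2 / M)%:C.
  rewrite -(subKr (q w) Q.[u]) (le_trans (ler_normB _ _))// rmorphD.
  by rewrite lerD ?qM ?qP.
rewrite (le_trans (ler_normD _ _))// !normrM.
have -> : e = M * (e / 2 / M) + e / 2 / (M + e / 2 / M) * (M + e / 2 / M).
  rewrite divfK ?gt_eqF// mulrC divfK ?gt_eqF//; lra.
rewrite rmorphD lerD//.
  by rewrite rmorphM ler_pM ?normr_ge0 ?hM ?qP.
by rewrite rmorphM ler_pM ?normr_ge0 ?hP.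
Qed.

(** The geometric series converges uniformly: its remainder [q ^+ n / (1 - q)] is at most
    [2 * 2^-1 ^+ n]. *)
Lemma disc_alg_geom z q : disc_alg z q ->
  (forall w : R[i], 0 <= Im w -> `|q w| <= 2^-1%:C) ->
  disc_alg z (fun w => (1 - q w)^-1).
Proof.
move=> zq q2.
have q1 w : 0 <= Im w -> `|q w| <= 1%:C.
  by move=> w0; rewrite (le_trans (q2 w w0))// lecR; lra.
have qX n : disc_alg z (fun w => q w ^+ n).
  elim: n => [|n IH].
    by under eq_fun do rewrite expr0; exact: disc_alg_cst.
  under eq_fun do rewrite exprS.
  apply: (disc_algM (M := 1)) => // w w0.
  by rewrite normrX exprn_ile1// q1.
have qS n : disc_alg z (fun w => \sum_(k < n) q w ^+ k).
  elim: n => [|n IH].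
    by under eq_fun do rewrite big_ord0; exact: disc_alg_cst.
  by under eq_fun do rewrite big_ord_recr/=; exact: disc_algD.
apply: disc_alg_ulim => e e0.
have [n _ /(_ n (leqnn n)) ne] : \forall n \near \oo, 2^-1 ^+ n < e / 2.
  have : (2^-1 : R) ^+ n @[n --> \oo] --> 0 by apply: cvg_expr; rewrite gtr0_norm//; lra.
  move/cvgrPdist_lt => /(_ _ (divr_gt0 e0 (ltr0Sn _ 1))); apply: filterS => n.
  by rewrite sub0r normrN ger0_norm// exprn_ge0.
exists (fun w => \sum_(k < n) q w ^+ k) => // w w0.
have q1n : 2^-1%:C <= `|1 - q w|.
  rewrite (le_trans _ (lerB_dist _ _))// normr1 lerBrDr.
  have -> : 1 = 2^-1%:C + 2^-1%:C :> R[i]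
    by rewrite -rmorphD/= -[LHS](rmorph1 (real_complex R)); congr (_%:C); lra.
  by rewrite lerD2l q2.
have q10 : 1 - q w != 0.
  by rewrite -normr_gt0 (lt_le_trans _ q1n)// ltcR.
have -> : (1 - q w)^-1 - \sum_(k < n) q w ^+ k = q w ^+ n / (1 - q w).
  apply: (mulIf q10); rewrite divfK// mulrBl mulVf//.
  by rewrite mulrC -[1 - q w]opprB mulNr -subrX1 opprB subKr.
rewrite normrM normfV normrX.
rewrite (@le_trans _ _ (2^-1%:C ^+ n * 2%:C))//.
  rewrite ler_pM ?exprn_ge0 ?invr_ge0//; first by rewrite lerXn2r ?nnegrE ?q2// lecR.
  by rewrite -[2%:C]invrK lef_pV2 ?posrE ?normr_gt0 ?invr_gt0 ?ltcR// -fmorphV.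
by rewrite -rmorphXn -rmorphM lecR -ler_pdivlMr// ltW.
Qed.

End disc_algebra.

Lemma Rintegral_dominated_cvg {d} {T : measurableType d} {R : realType}
    (mu : {measure set T -> \bar R}) (f_ : (T -> R)^nat) (f g : T -> R) :
  (forall n, measurable_fun [set: T] (f_ n)) -> measurable_fun [set: T] f ->
  {ae mu, forall t, f_ n t @[n --> \oo] --> f t} ->
  mu.-integrable [set: T] (EFin \o g) ->
  (forall n t, `|f_ n t| <= g t) ->
  \int[mu]_t f_ n t @[n --> \oo] --> \int[mu]_t f t.
Proof.
move=> mf_ mf f_f ig fg.
have [||||| i1 _ i2] := @dominated_convergence _ _ _ mu _ measurableT
    (fun n => EFin \o f_ n) (EFin \o f) (EFin \o g).
- by move=> n; exact/measurable_EFinP.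
- exact/measurable_EFinP.
- by apply: filterS f_f => t ft _; apply: cvg_EFin => //; exact: nearW.
- exact: ig.
- by apply: aeW => t n _; rewrite /= lee_fin.
apply: fine_cvg; rewrite /Rintegral fineK//.
exact: integrable_fin_num i1.
Qed.

(** * Cauchy kernels and Cauchy transforms in the disc algebra *)

Section cauchy_transform.
Context {R : realType}.
Implicit Types (z w a : R[i]).

(** This is the inverse of [cayley z a]. The pole of [w |-> 1 / (w - a)] thus sits where
    [cayley_ratio z a * cayley z w = 1], which suggests a geometric series in that product. *)
Definition cayley_ratio z a := (conjc z - a) / (z - a).

(** With [q] the ratio and [u] the Cayley image of [w], [(1 - u) / (z - a) = (1 - q * u) / (w - a)],
    so the partial geometric sum telescopes and the remainder is exact. *)
Lemma cauchy_kernel_geom z w a n : 0 < Im z -> 0 <= Im w -> Im a < 0 ->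
  (w - a)^-1 - (1 - cayley z w) / (z - a) *
    \sum_(k < n) (cayley_ratio z a * cayley z w) ^+ k =
  (cayley_ratio z a * cayley z w) ^+ n / (w - a).
Proof.
move=> z0 w0 a0; set q := cayley_ratio z a; set u := cayley z w.
have za : z - a != 0 by apply: Im_neq0; rewrite ImB; lra.
have wa : w - a != 0 by apply: Im_neq0; rewrite ImB; lra.
have wz := sub_conjc_neq0 z0 w0.
have -> : (1 - u) / (z - a) = (1 - q * u) / (w - a).
  by rewrite /q /u /cayley_ratio /cayley; field; rewrite za wa wz.
rewrite mulrAC -[1 - q * u]opprB mulNr -subrX1; field.
by rewrite wa.
Qed.

Lemma norm_cauchy_kernel_geom z w a n : 0 < Im z -> 0 <= Im w -> Im a < 0 ->
  `|(w - a)^-1 - (1 - cayley z w) / (z - a) *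
    \sum_(k < n) (cayley_ratio z a * cayley z w) ^+ k| <=
  `|cayley_ratio z a| ^+ n * (- Im a)^-1%:C.
Proof.
move=> z0 w0 a0; rewrite cauchy_kernel_geom//.
rewrite normrM normrX normrM ler_pM ?exprn_ge0 ?mulr_ge0//.
  rewrite lerXn2r ?nnegrE ?mulr_ge0//.
  by rewrite ler_piMr// norm_cayley_le1.
apply: ler_normV_Im; first by rewrite oppr_gt0.
by rewrite ImB ger0_norm; lra.
Qed.

(** A point [a] below the real axis is strictly nearer to [conjc z] than to [z]. The squared modulus
    is used because it is a real number, whereas the norm on [R[i]] is complex-valued; its powers
    are later integrated. *)
Lemma sqr_ratio_lt1 z a : 0 < Im z -> Im a < 0 ->
  Re (cayley_ratio z a) ^+ 2 + Im (cayley_ratio z a) ^+ 2 < 1.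
Proof.
move=> z0 a0; rewrite -ltcR add_Re2_Im2.
rewrite expr_lt1// normrM normfV ltr_pdivrMr ?normr_gt0; last first.
  by apply: Im_neq0; rewrite ImB; lra.
have h : 0 < Im z * - Im a by rewrite mulr_gt0 ?oppr_gt0.
have h' : 0 < (Im z - Im a) ^+ 2 by rewrite exprn_gt0//; lra.
rewrite mul1r !normc_def ltcR !ReB !ImB Re_conjc Im_conjc ltr_sqrt.
  by rewrite ltrD2l; nra.
by have := sqr_ge0 (Re z - Re a); lra.
Qed.

Lemma disc_alg_cauchy_kernel z a : 0 < Im z -> Im a < 0 ->
  disc_alg z (fun w => (w - a)^-1).
Proof.
move=> z0 a0 e e0; set q := cayley_ratio z a.
pose s := Re q ^+ 2 + Im q ^+ 2.
have s1 : s < 1 by exact: sqr_ratio_lt1.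
have s0 : 0 <= s by rewrite addr_ge0 ?sqr_ge0.
have a0' : 0 < - Im a by rewrite oppr_gt0.
have [n _ /(_ n (leqnn n)) ne] : \forall n \near \oo, s ^+ n < e * - Im a.
  have : s ^+ n @[n --> \oo] --> 0 by apply: cvg_expr; rewrite ger0_norm.
  move/cvgrPdist_lt => /(_ _ (mulr_gt0 e0 a0')); apply: filterS => n.
  by rewrite sub0r normrN ger0_norm// exprn_ge0.
(* With [2 * n] terms the remainder contains [|q| ^+ (2 * n)], which is the real number [s ^+ n]. *)
exists ((1 - 'X) * ((z - a)^-1%:P * \sum_(k < 2 * n) (q ^+ k)%:P * 'X^k)).
move=> w w0; set u := cayley z w.
have -> : ((1 - 'X) * ((z - a)^-1%:P * \sum_(k < 2 * n) (q ^+ k)%:P * 'X^k)).[u] =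
    (1 - u) / (z - a) * \sum_(k < 2 * n) (q * u) ^+ k.
  rewrite 2!hornerM hornerC horner_sum mulrA.
  congr (_ / _ * _); first by rewrite !hornerE.
  by apply: eq_bigr => k _; rewrite hornerM hornerC hornerXn [RHS]exprMn.
rewrite (le_trans (norm_cauchy_kernel_geom _ _ _ _))// -/q exprM -add_Re2_Im2.
by rewrite -rmorphXn -rmorphM lecR ler_pdivrMr// ltW.
Qed.

Variable mu : probability (measurableTypeR R) R.

Definition cauchy_transform z := cintegral mu (fun t : R => (z - t%:C)^-1).

Lemma cmeasurable_real : cmeasurable (fun t : measurableTypeR R => t%:C).
Proof. by apply: cmeasurableC; exact: measurable_id. Qed.

Lemma cmeasurable_cauchy_kernel z :
  cmeasurable (fun t : measurableTypeR R => (z - t%:C)^-1).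
Proof.
apply: cmeasurableV; apply: cmeasurableB; first exact: cmeasurable_cst.
exact: cmeasurable_real.
Qed.

Lemma norm_cauchy_kernel_le z t : 0 < Im z ->
  `|(z - t%:C)^-1| <= (Im z)^-1%:C.
Proof.
by move=> z0; apply: ler_normV_Im => //; rewrite ImB/= subr0 ler_norm.
Qed.

Lemma integrable_prob_cst (c : R) :
  mu.-integrable [set: measurableTypeR R] (EFin \o cst c).
Proof. exact: finite_measure_integrable_cst. Qed.

Lemma cintegrable_bounded (f : measurableTypeR R -> R[i]) (M : R) :
  cmeasurable f -> (forall t, `|f t| <= M%:C) -> cintegrable mu f.
Proof.
move=> mf fM; apply: (le_cintegrable (g := cst M)) => //.
exact: integrable_prob_cst.
Qed.

(** The shift by [e] moves the pole of each kernel to [a t = t - i e], below the axis, and the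
    geometric expansion is integrated term by term. The ratios [s t] are not bounded away from 1 as
    [t] goes to infinity, so the remainder is not uniform in [t]; its integral nevertheless tends to
    0 by dominated convergence, uniformly in [w]. *)
Lemma disc_alg_cauchy_transform z (e : R) : 0 < Im z -> 0 < e ->
  disc_alg z (fun w => cauchy_transform (w + 0 +i* e)).
Proof.
move=> z0 e0 r r0.
pose a (t : measurableTypeR R) : R[i] := t%:C - 0 +i* e.
have a0 t : Im (a t) = - e by rewrite /a /= sub0r.
have a0' t : Im (a t) < 0 by rewrite a0 oppr_lt0.
pose q t := cayley_ratio z (a t).
pose s t := Re (q t) ^+ 2 + Im (q t) ^+ 2.
have ma : cmeasurable a.
  apply: cmeasurableB; [exact: cmeasurable_real|exact: cmeasurable_cst].
have mza : cmeasurable (fun t => (z - a t)^-1).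
  by apply: cmeasurableV; apply: cmeasurableB => //; exact: cmeasurable_cst.
have mq : cmeasurable q.
  apply: cmeasurableM => //.
  by apply: cmeasurableB => //; exact: cmeasurable_cst.
have ms : measurable_fun [set: measurableTypeR R] s.
  by case: mq => ? ?; apply: measurable_funD; exact: measurable_funX.
have s0 t : 0 <= s t by rewrite addr_ge0 ?sqr_ge0.
have s1 t : s t < 1 by exact: sqr_ratio_lt1.
have qs t : `|q t| ^+ 2 = (s t)%:C by rewrite -add_Re2_Im2.
have sn1 n t : `|s t ^+ n| <= 1.
  by rewrite ger0_norm ?exprn_ge0// exprn_ile1// ltW.
have cvgs : \int[mu]_t (s t ^+ n) @[n --> \oo] --> (0 : R).
  rewrite [X in _ --> X](_ : _ = \int[mu]_t cst 0 t); last first.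
    by rewrite /Rintegral integral0.
  apply: (Rintegral_dominated_cvg (g := cst 1)) => //.
  - by move=> n; exact: measurable_funX.
  - by apply: aeW => t; apply: cvg_expr; rewrite ger0_norm.
  - exact: integrable_prob_cst.
(* The tolerance [r * e / 2] pays for the factor 2 of [ler_norm_cintegral] and for the bound [e^-1]
   on the kernel. *)
have [n _ /(_ n (leqnn n)) ne] : \forall n \near \oo, \int[mu]_t (s t ^+ n) < r * e / 2.
  move/cvgrPdist_lt : cvgs => /(_ _ (divr_gt0 (mulr_gt0 r0 e0) (ltr0Sn _ 1))).
  apply: filterS => n; rewrite sub0r normrN; exact/le_lt_trans/ler_norm.
pose c k := cintegral mu (fun t => q t ^+ k / (z - a t)).
have q1 t : `|q t| <= 1 by rewrite -(@expr_le1 _ 2)// qs lecR ltW.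
have zae t : `|(z - a t)^-1| <= e^-1%:C.
  apply: ler_normV_Im => //; rewrite ImB a0 opprK ger0_norm; lra.
have cq k : cintegrable mu (fun t => q t ^+ k / (z - a t)).
  apply: (@cintegrable_bounded _ e^-1).
    by apply: cmeasurableM => //; exact: cmeasurableX.
  move=> t; rewrite normrM normrX -[leRHS]mul1r ler_pM ?exprn_ge0//.
  by rewrite exprn_ile1.
exists ((1 - 'X) * \sum_(k < 2 * n) (c k)%:P * 'X^k).
move=> w w0; set u := cayley z w.
have wz := sub_conjc_neq0 z0 w0.
pose F k t := (1 - u) * u ^+ k * (q t ^+ k / (z - a t)).
have iF k : cintegrable mu (F k) by exact: cintegrableZl.
pose f t := \sum_(k < 2 * n) F k t.
have -> : ((1 - 'X) * \sum_(k < 2 * n) (c k)%:P * 'X^k).[u] = cintegral mu f.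
  rewrite (cintegral_sum _ iF).
  rewrite hornerM horner_sum mulr_sumr; apply: eq_bigr => k _.
  have -> : cintegral mu (F k) = (1 - u) * u ^+ k * c k by exact: cintegralZl.
  by rewrite hornerD hornerN hornerM !hornerC hornerXn hornerX; ring.
have wat t : w + 0 +i* e - t%:C = w - a t by rewrite /a; ring.
have cw : cmeasurable (fun t : measurableTypeR R => (w + 0 +i* e - t%:C)^-1).
  exact: cmeasurable_cauchy_kernel.
have cf : cintegrable mu f by exact: cintegrable_sum.
rewrite -cintegralB//; last first.
  apply: (@cintegrable_bounded _ e^-1) => // t.
  by apply: ler_normV_Im => //; rewrite wat ImB a0 opprK ger0_norm; lra.
have mf : cmeasurable f.
  case: cf => /measurable_int/measurable_EFinP f1 /measurable_int/measurable_EFinP f2.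
  by split.
have ise : mu.-integrable [set: measurableTypeR R] (EFin \o (fun t => s t ^+ n)).
  apply: (le_integrable _ _ _ (integrable_prob_cst 1)) => //.
    by apply/measurable_EFinP; exact: measurable_funX.
  by move=> t _; rewrite lee_fin normr1.
have fE t : f t = (1 - u) / (z - a t) * \sum_(k < 2 * n) (q t * u) ^+ k.
  by rewrite mulr_sumr; apply: eq_bigr => k _; rewrite /F [(q t * u) ^+ k]exprMn; ring.
apply: (le_trans (ler_norm_cintegral (g := fun t => s t ^+ n * e^-1) _ _ _)).
- exact: cmeasurableB.
- rewrite /comp; under eq_fun do rewrite EFinM.
  exact: integrableZr.
- move=> t; rewrite fE wat (le_trans (norm_cauchy_kernel_geom _ _ _ _))//.
  by rewrite -/(q t) exprM qs a0 opprK -rmorphXn -rmorphM.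
rewrite lecR RintegralZr// mulrA ler_pdivrMr// -ler_pdivlMl// mulrC.
exact: ltW.
Qed.

End cauchy_transform.

(** * Poisson's formula *)

Section symmetric_integrals.
Context {R : realType}.
Local Notation leb := (@lebesgue_measure R).
Implicit Types f F : R -> R.

Lemma is_derive_FTC f F (a b : R) : a < b -> continuous f ->
  (forall x : R, is_derive x 1 F (f x)) ->
  (\int[leb]_(x in `[a, b]) (f x)%:E = (F b - F a)%:E)%E.
Proof.
move=> ab cf dF.
have cF : continuous F.
  by move=> x; apply/differentiable_continuous/derivable1_diffP; apply: ex_derive.
rewrite (@continuous_FTC2 _ f F)//.
- exact: continuous_subspaceT.
- split => [x _||]; first exact: ex_derive.
  + by apply: cvg_at_right_filter; exact: cF.
  + by apply: cvg_at_left_filter; exact: cF.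
- by move=> x _; rewrite derive1E; exact: derive_val.
Qed.

Definition symitv n : set R := `[- n.+1%:R, n.+1%:R]%classic.

Lemma symitv_lt n : - n.+1%:R < n.+1%:R :> R.
Proof. by rewrite (@lt_trans _ _ 0) ?oppr_lt0 ?ltr0n. Qed.

Lemma measurable_symitv n : measurable (symitv n).
Proof. exact: measurable_itv. Qed.

Lemma nondecreasing_symitv :
  {homo symitv : n m / (n <= m)%N >-> (n <= m)%O}.
Proof.
move=> n m nm; apply/subsetPset => x; rewrite /symitv/= !in_itv/= => /andP[nx xn].
have nm' : n.+1%:R <= m.+1%:R :> R by rewrite ler_nat.
by rewrite (le_trans _ nx) ?lerN2// (le_trans xn).
Qed.

Lemma bigcup_symitv : \bigcup_n symitv n = setT.
Proof.
apply/seteqP; split => // x _; exists (Num.truncn `|x|) => //=.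
by rewrite /symitv/= in_itv/= -ler_norml ltW// truncnS_gt.
Qed.

(** Monotone convergence yields the value without prior integrability, which for the Poisson kernel
    is deduced from it. [Rintegral_symitv] is the signed counterpart, by dominated convergence. *)
Lemma ge0_integral_symitv f F (l : R) : continuous f -> (forall x, 0 <= f x) ->
  (forall x : R, is_derive x 1 F (f x)) ->
  F n.+1%:R - F (- n.+1%:R) @[n --> \oo] --> l ->
  (\int[leb]_x (f x)%:E = l%:E)%E.
Proof.
move=> cf f0 dF Fl.
have mf : measurable_fun setT (EFin \o f).
  by apply/measurable_EFinP; exact: continuous_measurable_fun.
have := @ge0_nondecreasing_set_cvg_integral _ (measurableTypeR R) R symitv (EFin \o f) leb
  nondecreasing_symitv.
rewrite bigcup_symitv => h.
apply: (@cvg_unique _ _ (\int[leb]_(x in symitv n) (f x)%:E @[n --> \oo])%E).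
- exact: ereal_hausdorff.
- apply: h => [i|i|i x _]; first exact: measurable_itv.
    exact: measurable_funTS.
  by rewrite /= lee_fin.
- have -> : (fun n => (\int[leb]_(x in symitv n) (f x)%:E)%E) =
      EFin \o (fun n => F n.+1%:R - F (- n.+1%:R)).
    by apply/funext => n; exact: is_derive_FTC (symitv_lt _) cf dF.
  by apply: cvg_EFin => //; exact: nearW.
Qed.

Lemma Rintegral_symitv f F (l : R) : continuous f ->
  leb.-integrable setT (EFin \o f) ->
  (forall x : R, is_derive x 1 F (f x)) ->
  F n.+1%:R - F (- n.+1%:R) @[n --> \oo] --> l ->
  \int[leb]_x f x = l.
Proof.
move=> cf intf dF Fl.
have mf : measurable_fun setT f by exact: continuous_measurable_fun.
have h : \int[leb]_x (f \_ (symitv n)) x @[n --> \oo] --> \int[leb]_x f x.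
  apply: (@Rintegral_dominated_cvg _ (measurableTypeR R) R leb
    (fun n => f \_ (symitv n)) f (fun x => `|f x|)) => //.
  - move=> n; apply/measurable_restrict => //; first exact: measurable_symitv.
    exact: measurable_funTS.
  - apply: aeW => x; apply: cvg_near_cst; exists (Num.truncn `|x|) => // n /= xn.
    rewrite patchE mem_set//; apply: (subsetPset _ _ (nondecreasing_symitv xn)).
    by rewrite /symitv/= in_itv/= -ler_norml ltW// truncnS_gt.
  - exact: integrable_norm intf.
  - by move=> n x; rewrite patchE; case: ifP => //; rewrite normr0.
apply: (cvg_unique _ h) => //.
have -> : (fun n => \int[leb]_x (f \_ (symitv n)) x) =
    (fun n => F n.+1%:R - F (- n.+1%:R)).
  apply/funext => n; rewrite -Rintegral_mkcond /Rintegral.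
  by rewrite (is_derive_FTC (symitv_lt _) cf dF).
exact: Fl.
Qed.

End symmetric_integrals.

Section poisson_kernel.
Context {R : realType}.
Local Notation leb := (@lebesgue_measure R).
Implicit Types (z : R[i]) (t : R).

Definition poisson z t : R := Im z / (pi * ((t - Re z) ^+ 2 + Im z ^+ 2)).

Variable z : R[i].
Hypothesis z0 : 0 < Im z.

Lemma sqr_dist_gt0 t : 0 < (t - Re z) ^+ 2 + Im z ^+ 2.
Proof. by rewrite ltr_wpDl ?sqr_ge0// exprn_gt0. Qed.

Lemma poisson_gt0 t : 0 < poisson z t.
Proof. by rewrite divr_gt0// mulr_gt0 ?pi_gt0 ?sqr_dist_gt0. Qed.

Lemma poisson_ge0 t : 0 <= poisson z t.
Proof. by rewrite ltW ?poisson_gt0. Qed.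

Lemma continuous_poisson : continuous (poisson z).
Proof.
move=> t; apply: cvgM; first exact: cvg_cst.
apply: cvgV; first by rewrite gt_eqF// mulr_gt0 ?pi_gt0 ?sqr_dist_gt0.
apply: cvgM; first exact: cvg_cst.
apply: cvgD; last exact: cvg_cst.
have c : (x - Re z) @[x --> t] --> (t - Re z).
  by apply: cvgB; [exact: cvg_id|exact: cvg_cst].
by under eq_fun do rewrite expr2; rewrite expr2; exact: cvgM.
Qed.

Definition poisson_primitive t := pi^-1 * atan ((t - Re z) / Im z).

Lemma is_derive_poisson t : is_derive t 1 poisson_primitive (poisson z t).
Proof.
rewrite /poisson_primitive.
have -> : (fun t => pi^-1 * atan ((t - Re z) / Im z)) =
    pi^-1 *: (atan \o ((Im z)^-1 *: (@id R - cst (Re z)))).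
  by apply/funext => x; rewrite [RHS]/(pi^-1 * atan ((Im z)^-1 * (x - Re z))) [_ / Im z]mulrC.
apply: is_derive_eq.
rewrite /poisson /GRing.scale/= subr0 mulr1.
rewrite -[_ *: _]/((Im z)^-1 * (t - Re z)).
have := sqr_dist_gt0 t; have := pi_gt0 R; have := z0 => ? ? ?.
field; by apply/and3P; split; rewrite gt_eqF//; lra.
Qed.

Lemma cvg_affine_pinfty (c y : R) : 0 < y ->
  (n.+1%:R - c) / y @[n --> \oo] --> +oo.
Proof.
move=> y0; apply/cvgryPge => A; near=> n.
rewrite ler_pdivlMr// lerBrDr (@le_trans _ _ n%:R) ?ler_nat//.
by near: n; exact: nbhs_infty_ger.
Unshelve. all: by end_near. Qed.

Lemma cvg_poisson_primitive :
  poisson_primitive n.+1%:R - poisson_primitive (- n.+1%:R) @[n --> \oo] --> (1 : R).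
Proof.
have h (c : R) : pi^-1 * atan ((n.+1%:R - c) / Im z) @[n --> \oo] --> (2^-1 : R).
  have -> : 2^-1 = pi^-1 * (pi / 2) :> R.
    by rewrite mulKf ?gt_eqF ?pi_gt0.
  apply: cvgM; first exact: cvg_cst.
  apply: (@cvg_comp _ _ _ _ atan _ +oo); last exact: cvgy_atan.
  exact: cvg_affine_pinfty.
rewrite [X in _ --> X](_ : 1 = 2^-1 + 2^-1 :> R); last lra.
have -> : (fun n => poisson_primitive n.+1%:R - poisson_primitive (- n.+1%:R)) =
    (fun n => pi^-1 * atan ((n.+1%:R - Re z) / Im z) +
              pi^-1 * atan ((n.+1%:R - - Re z) / Im z)).
  apply/funext => n.
  by rewrite /poisson_primitive -opprD mulNr atanN mulrN !opprK.
by apply: cvgD; exact: h.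
Qed.

Lemma integral_poisson : (\int[leb]_t (poisson z t)%:E = 1)%E.
Proof.
apply: (ge0_integral_symitv _ _ is_derive_poisson cvg_poisson_primitive).
  exact: continuous_poisson.
exact: poisson_ge0.
Qed.

Lemma measurable_poisson : measurable_fun [set: R] (poisson z).
Proof. exact: continuous_measurable_fun continuous_poisson. Qed.

Lemma integrable_poisson : leb.-integrable setT (EFin \o poisson z).
Proof.
apply/integrableP; split; first by apply/measurable_EFinP; exact: measurable_poisson.
under eq_integral do rewrite /= ger0_norm ?poisson_ge0//.
by rewrite integral_poisson ltry.
Qed.

End poisson_kernel.

Section complex_derivative.
Context {R : realType}.
Implicit Types (f g : R -> R[i]) (t : R).

Definition is_cderive t f (df : R[i]) :=
  is_derive t 1 (fun s => Re (f s)) (Re df) /\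
  is_derive t 1 (fun s => Im (f s)) (Im df).

Lemma is_cderive_cst t c : is_cderive t (fun=> c) 0.
Proof. by split; exact: is_derive_cst. Qed.

Lemma is_cderiveD t f g df dg : is_cderive t f df -> is_cderive t g dg ->
  is_cderive t (fun s => f s + g s) (df + dg).
Proof.
move=> [f1 f2] [g1 g2]; split.
  by under eq_fun do rewrite ReD; rewrite ReD; exact: is_deriveD.
by under eq_fun do rewrite ImD; rewrite ImD; exact: is_deriveD.
Qed.

Lemma is_cderiveM t f g df dg : is_cderive t f df -> is_cderive t g dg ->
  is_cderive t (fun s => f s * g s) (df * g t + f t * dg).
Proof.
move=> [f1 f2] [g1 g2]; split.
  under eq_fun do rewrite ReM.
  apply: (is_derive_eq (is_deriveB (is_deriveM f1 g1) (is_deriveM f2 g2))).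
  by rewrite /GRing.scale/= ReD !ReM; ring.
under eq_fun do rewrite ImM.
apply: (is_derive_eq (is_deriveD (is_deriveM f1 g2) (is_deriveM f2 g1))).
by rewrite /GRing.scale/= ImD !ImM; ring.
Qed.

Lemma is_cderiveX t f df n : is_cderive t f df ->
  is_cderive t (fun s => f s ^+ n.+1) (n.+1%:R * f t ^+ n * df).
Proof.
move=> f'; elim: n => [|n IH].
  by rewrite expr0 !mul1r; under eq_fun do rewrite expr1.
under eq_fun do rewrite exprS.
have := is_cderiveM f' IH; congr is_cderive.
by rewrite !exprS -[n.+2%:R]natr1; ring.
Qed.

Lemma is_cderiveZl t f df c : is_cderive t f df ->
  is_cderive t (fun s => c * f s) (c * df).
Proof.
move=> f'; have := is_cderiveM (is_cderive_cst t c) f'.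
by rewrite mul0r add0r.
Qed.

End complex_derivative.

(** * The Cayley transform along the real line *)

Section cayley_line.
Context {R : realType}.
Variable z : R[i].
Hypothesis z0 : 0 < Im z.
Implicit Type t : R.

Let v t := (t%:C - conjc z)^-1.
Let u t := cayley z t%:C.

Let vE t : v t = (t - Re z) / ((t - Re z) ^+ 2 + Im z ^+ 2)
  -i* (Im z / ((t - Re z) ^+ 2 + Im z ^+ 2)).
Proof.
apply: complexP; rewrite ?ReV ?ImV !ReB !ImB Re_conjc Im_conjc /= sub0r.
  by rewrite opprK.
by rewrite !opprK mulNr.
Qed.

Let tz0 t : t%:C - conjc z != 0.
Proof. exact: sub_conjc_neq0. Qed.

Let tz0' t : t%:C - z != 0.
Proof. by apply: Im_neq0; rewrite ImB/= sub0r oppr_eq0 gt_eqF. Qed.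

Let zzc : z - conjc z = (2 * Im z)%:C * 'i.
Proof. by apply: complexP; rewrite ?ReB ?ImB ?ReM ?ImM ?Re_conjc ?Im_conjc /=; ring. Qed.

Let uE t : u t = 1 - (z - conjc z) * v t.
Proof. by rewrite /u /cayley /v; field; rewrite tz0. Qed.

Let is_cderive_v t : is_cderive t v (- v t ^+ 2).
Proof.
have D0 := sqr_dist_gt0 z0.
have D0' s : (s - Re z) ^+ 2 + Im z ^+ 2 != 0 by rewrite gt_eqF.
pose D : R -> R := (@id R - cst (Re z)) ^+ 2 + cst (Im z ^+ 2).
have DE s : D s = (s - Re z) ^+ 2 + Im z ^+ 2 by [].
have dD : is_derive t 1 (fun s => (D s)^-1) (- (D t) ^- 2 *: (2 * (t - Re z))).
  apply: is_deriveV; first exact: D0'.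
  apply: is_derive_eq; rewrite /GRing.scale/= subr0 addr0 mulr1 expr1.
  by rewrite -mulr_natl; congr (_ * _).
split.
  have -> : (fun s => Re (v s)) = (@id R - cst (Re z)) * (fun s => (D s)^-1).
    by apply/funext => s; rewrite vE.
  apply: is_derive_eq.
  rewrite ReN expr2 ReM vE /= /GRing.scale/= -[(id - _) t]/(t - Re z) DE.
  by field.
have -> : (fun s => Im (v s)) = cst (- Im z) * (fun s => (D s)^-1).
  by apply/funext => s; rewrite vE /= -mulNr.
apply: is_derive_eq.
rewrite ImN expr2 ImM vE /= /GRing.scale/= DE.
by field.
Qed.

(** [cayley z] is affine in [v t], the inverse of [t - conjc z], and [v] has derivative
    [- v ^+ 2]. *)
Lemma is_cderive_cayley t : is_cderive t (fun s => cayley z s%:C)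
  ((z - conjc z) * (t%:C - conjc z) ^- 2).
Proof.
have -> : (fun s => cayley z s%:C) = (fun s => 1 + - (z - conjc z) * v s).
  by apply/funext => s; rewrite mulNr -uE.
have := is_cderiveD (is_cderive_cst t 1)
  (is_cderiveZl (- (z - conjc z)) (is_cderive_v t)).
by congr is_cderive; rewrite add0r mulrNN /v exprVn.
Qed.

(** On the line the Poisson kernel is [u' / (2 pi i u)] with [u] the Cayley image: the Cauchy law of
    [z] is normalised arc length on the circle. Hence [poisson z * u ^+ n.+1] has the primitive
    [u ^+ n.+1 / (2 pi i (n + 1))]. *)
Lemma poisson_cayley t : (poisson z t)%:C * cayley z t%:C =
  ((2 * pi)%:C * 'i)^-1 * ((z - conjc z) * (t%:C - conjc z) ^- 2).
Proof.
have pi0 : (pi%:C : R[i]) != 0 by rewrite fmorph_eq0 gt_eqF// pi_gt0.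
have i0 : ('i : R[i]) != 0 by apply: Im_neq0; rewrite /= oner_eq0.
have DE : ((t - Re z) ^+ 2 + Im z ^+ 2)%:C = (t%:C - z) * (t%:C - conjc z).
  by apply: complexP; rewrite ?ReM ?ImM ?ReB ?ImB ?Re_conjc ?Im_conjc /=; ring.
have -> : (poisson z t)%:C =
    (Im z)%:C / (pi%:C * ((t%:C - z) * (t%:C - conjc z))).
  by rewrite /poisson -DE -rmorphM -fmorphV -rmorphM.
rewrite /cayley zzc !realcM.
have z0C : (Im z)%:C != 0 :> R[i] by rewrite fmorph_eq0 gt_eqF.
set p : R[i] := pi%:C in pi0 *; set y : R[i] := (Im z)%:C in z0C *.
set i : R[i] := 'i in i0 *.
have t0 : 2%:C != 0 :> R[i] by rewrite fmorph_eq0 pnatr_eq0.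
set tw : R[i] := 2%:C in t0 *.
clearbody p y i tw; field.
by rewrite pi0 i0 t0 tz0 tz0'.
Qed.

Lemma is_derive_poisson_cayley c n t :
  is_derive t 1
    (fun s => Im (c / ((2 * pi)%:C * 'i * n.+1%:R) * cayley z s%:C ^+ n.+1))
    (poisson z t * Im (c * cayley z t%:C ^+ n.+1)).
Proof.
have [_] := is_cderiveZl (c / ((2 * pi)%:C * 'i * n.+1%:R))
  (is_cderiveX n (is_cderive_cayley t)).
congr is_derive.
have -> : poisson z t * Im (c * cayley z t%:C ^+ n.+1) =
    Im ((poisson z t)%:C * (c * cayley z t%:C ^+ n.+1)).
  by rewrite ImM /= mul0r addr0.
have -> : (poisson z t)%:C * (c * cayley z t%:C ^+ n.+1) =
    c * cayley z t%:C ^+ n * ((poisson z t)%:C * cayley z t%:C).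
  by rewrite exprSr; ring.
rewrite poisson_cayley; congr Im.
have n0 : n.+1%:R != 0 :> R[i] by rewrite pnatr_eq0.
have i0 : (2 * pi)%:C * 'i != 0 :> R[i].
  apply: Im_neq0; rewrite ImM /= mulr0 mulr1 addr0.
  by rewrite gt_eqF// mulr_gt0 ?pi_gt0.
set k := _ * 'i in i0 *; clearbody k; field.
by rewrite nat1r n0 i0 tz0.
Qed.

End cayley_line.

Lemma cvg_dist_bound {R : realType} (f b : nat -> R) (l : R) :
  (\forall k \near \oo, `|l - f k| <= b k) -> b @ \oo --> (0 : R) ->
  f @ \oo --> l.
Proof.
move=> fb b0; apply/cvgrPdist_le => e e0.
move/cvgrPdist_le : b0 => /(_ _ e0); apply: filterS2 fb => k lf.
by rewrite sub0r normrN; apply: le_trans; rewrite (le_trans lf) ?ler_norm.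
Qed.

Section poisson_formula.
Context {R : realType}.
Local Notation leb := (@lebesgue_measure R).
Variable z : R[i].
Hypothesis z0 : 0 < Im z.
Implicit Type t : R.

Lemma integrable_poissonM (g : R -> R) (M : R) : measurable_fun [set: R] g ->
  (forall t, `|g t| <= M) ->
  leb.-integrable setT (EFin \o (fun t => poisson z t * g t)).
Proof.
move=> mg gM.
apply: (@le_integrable _ (measurableTypeR R) R leb _ _
  (EFin \o (fun t => poisson z t * g t)) (fun t => M%:E * (poisson z t)%:E)%E) => //.
- by apply/measurable_EFinP/measurable_funM => //; exact: measurable_poisson.
- move=> t _; rewrite /= lee_fin normrM mulrC [leRHS]normrM.
  by rewrite ler_wpM2r// (le_trans (gM t)) ?ler_norm.
- exact/integrableZl/integrable_poisson.
Qed.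

Lemma norm_RintegralM_poisson (g : R -> R) (M : R) :
  measurable_fun [set: R] g -> (forall t, `|g t| <= M) ->
  `|\int[leb]_t (poisson z t * g t)| <= M.
Proof.
move=> mg gM; have ig := integrable_poissonM mg gM.
apply: (le_trans (le_normr_Rintegral _ ig)) => //.
apply: (@le_trans _ _ (\int[leb]_t (poisson z t * M))).
  apply: le_Rintegral => //.
  - exact: (integrable_norm ig).
  - by apply: (@integrable_poissonM _ `|M|) => //; exact: measurable_cst.
  - by move=> t _; rewrite normrM (ger0_norm (poisson_ge0 z0 t)) ler_wpM2l ?poisson_ge0.
rewrite RintegralZr//; last exact: integrable_poisson.
by rewrite /Rintegral integral_poisson// mul1r.
Qed.

Lemma cmeasurable_cayley : cmeasurable (fun t : measurableTypeR R => cayley z t%:C).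
Proof.
apply: cmeasurableM.
  by apply: cmeasurableB; [exact: cmeasurable_real|exact: cmeasurable_cst].
by apply/cmeasurableV/cmeasurableB; [exact: cmeasurable_real|exact: cmeasurable_cst].
Qed.

Lemma horner_bounded (P : {poly R[i]}) : exists2 M : R, 0 <= M &
  forall w, `|w| <= 1 -> `|P.[w]| <= M%:C.
Proof.
elim/poly_ind: P => [|P c [M M0 IH]].
  by exists 0 => // w _; rewrite horner0 normr0.
exists (M + (`|Re c| + `|Im c|)); first by rewrite !addr_ge0.
move=> w w1; rewrite hornerMXaddC (le_trans (ler_normD _ _))//.
rewrite [leRHS]rmorphD lerD ?ler_normc_add// normrM -[leRHS]mulr1.
by rewrite ler_pM ?IH.
Qed.

Lemma norm_cayley_real t : `|cayley z t%:C| <= 1.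
Proof. by rewrite norm_cayley_le1. Qed.

Lemma measurable_Im_horner_cayley (P : {poly R[i]}) :
  measurable_fun [set: R] (fun t : R => Im P.[cayley z t%:C]).
Proof. by have [] := cmeasurable_horner P cmeasurable_cayley. Qed.

(** The Cayley transform closes the line up to a circle: [1 - cayley z t = (z - conjc z) / (t -
    conjc z)] vanishes at both ends. The boundary terms of a primitive that is a power of [cayley z]
    therefore cancel. *)
Lemma cvg_cayley_pow (a : nat -> R) c n :
  (fun k => `|a k - Re z|) @ \oo --> +oo ->
  Im (c * cayley z (a k)%:C ^+ n) @[k --> \oo] --> Im c.
Proof.
move=> aoo.
pose w k := cayley z (a k)%:C.
have aoo' : (`|a k - Re z|)^-1 @[k --> \oo] --> (0 : R).
  apply/gtr0_cvgV0 => //.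
  by near=> k; near: k; move/cvgryPgt : aoo => /(_ 0).
have h k : 0 < `|a k - Re z| ->
    `|1 - w k| <= (2 * Im z * (`|a k - Re z|)^-1)%:C.
  move=> ak0.
  have az : (a k)%:C - conjc z != 0 by exact: sub_conjc_neq0.
  have -> : 1 - w k = (z - conjc z) * ((a k)%:C - conjc z)^-1.
    by rewrite /w /cayley; field; rewrite az.
  rewrite normrM realcM ler_pM//.
    rewrite (le_trans (ler_normc_add _))// ReB ImB Re_conjc Im_conjc subrr opprK.
    by rewrite normr0 add0r gtr0_norm ?addr_gt0// lecR mulr_natl mulr2n.
  rewrite normfV fmorphV lef_pV2 ?posrE ?normr_gt0// ?ltcR//.
  by rewrite (le_trans _ (ler_normRe _))// lecR ReB Re_conjc.
have w1 k : `|w k| <= 1 by exact: norm_cayley_real.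
have hn k : `|1 - w k ^+ n| <= n%:R%:C * `|1 - w k|.
  elim: n => [|n IH]; first by rewrite subrr normr0 mul0r.
  have -> : 1 - w k ^+ n.+1 = (1 - w k) + w k * (1 - w k ^+ n).
    by rewrite exprS; ring.
  rewrite (le_trans (ler_normD _ _))// -nat1r rmorphD mulrDl mul1r lerD2l.
  by rewrite normrM (le_trans _ IH)// ler_piMl.
pose C := `|Re c| + `|Im c|.
apply: (@cvg_dist_bound _ _ (fun k => C * n%:R * (2 * Im z) * (`|a k - Re z|)^-1)).
  near=> k.
  have ak0 : 0 < `|a k - Re z| by near: k; move/cvgryPgt : aoo => /(_ 0).
  rewrite -ImB -lecR (le_trans (ler_normIm _))//.
  have -> : c - c * w k ^+ n = c * (1 - w k ^+ n) by ring.
  rewrite normrM -!mulrA realcM ler_pM ?ler_normc_add//.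
  rewrite (le_trans (hn k))// realcM [2 * (_ / _)]mulrA.
  by apply: ler_wpM2l; rewrite ?h// ler0c.
rewrite -[X in _ --> X](mulr0 (C * n%:R * (2 * Im z))).
by apply: cvgM => //; exact: cvg_cst.
Unshelve. all: by end_near. Qed.

Lemma cvg_abs_pinfty (c : R) : `|n.+1%:R - c| @[n --> \oo] --> +oo /\
  `|- n.+1%:R - c| @[n --> \oo] --> +oo.
Proof.
have h (b : R) : `|n.+1%:R - b| @[n --> \oo] --> +oo.
  have /cvgryPge bn := cvg_affine_pinfty b (@ltr01 R).
  apply/cvgryPge => A; near=> n; rewrite (le_trans _ (ler_norm _))//.
  by rewrite -[leRHS]divr1; near: n; exact: bn.
split; first exact: h.
under eq_fun do rewrite -opprD normrN -[X in _ + X]opprK.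
exact: h.
Unshelve. all: by end_near. Qed.

Lemma Rintegral_poisson_cayley c n :
  \int[leb]_t (poisson z t * Im (c * cayley z t%:C ^+ n.+1)) = 0.
Proof.
have [M M0 cM] := horner_bounded (c *: 'X^(n.+1)).
have [h1 h2] := cvg_abs_pinfty (Re z).
apply: (Rintegral_symitv _ _ (is_derive_poisson_cayley z0 c n)).
- move=> t; apply: cvgM; first exact: continuous_poisson.
  have [_ [+ _]] := is_cderiveZl c (is_cderiveX n (is_cderive_cayley z0 t)).
  by move=> /derivable1_diffP/differentiable_continuous.
- apply: (@integrable_poissonM _ M).
    have := measurable_Im_horner_cayley (c *: 'X^(n.+1)).
    by under eq_fun do rewrite hornerZ hornerXn.
  move=> t; rewrite -lecR (le_trans (ler_normIm _))//.
  by rewrite -[_ ^+ _]hornerXn -hornerZ cM ?norm_cayley_real.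
- set k := c / _.
  rewrite -[X in _ --> X](subrr (Im k)).
  by apply: cvgB; exact: cvg_cayley_pow.
Qed.

(** Positive powers of the Cayley image integrate to 0, so only the constant coefficient survives.
    It is the value at [z], since [cayley z z = 0]. *)
Lemma Rintegral_poisson_horner (P : {poly R[i]}) :
  \int[leb]_t (poisson z t * Im P.[cayley z t%:C]) = Im P.[0].
Proof.
have iP (Q : {poly R[i]}) : leb.-integrable setT
    (EFin \o (fun t => poisson z t * Im Q.[cayley z t%:C])).
  have [M _ QM] := horner_bounded Q.
  apply: (@integrable_poissonM _ M); first exact: measurable_Im_horner_cayley.
  by move=> t; rewrite -lecR (le_trans (ler_normIm _))// QM// norm_cayley_real.
(* Multiples of ['X] are treated with a free exponent [n], because peeling off a coefficient of [Q]
   raises the exponent by one. *)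
have H n (Q : {poly R[i]}) :
    \int[leb]_t (poisson z t * Im (Q * 'X^(n.+1)).[cayley z t%:C]) = 0.
  elim/poly_ind: Q n => [|Q c IH] n.
    under eq_Rintegral do rewrite mul0r horner0 mulr0.
    by rewrite /Rintegral integral0.
  have -> : (Q * 'X + c%:P) * 'X^(n.+1) = Q * 'X^(n.+2) + c%:P * 'X^(n.+1).
    by rewrite mulrDl -mulrA -exprS.
  under eq_Rintegral do rewrite hornerD ImD mulrDr.
  rewrite RintegralD// IH add0r.
  under eq_Rintegral do rewrite hornerM hornerC hornerXn.
  exact: Rintegral_poisson_cayley.
elim/poly_ind: P => [|P c _].
  under eq_Rintegral do rewrite horner0 mulr0.
  by rewrite horner0 /Rintegral integral0.
under eq_Rintegral do rewrite hornerD ImD mulrDr.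
rewrite RintegralD// -['X]expr1 H add0r.
under eq_Rintegral do rewrite hornerC.
rewrite RintegralZr//; last exact: integrable_poisson.
by rewrite {1}/Rintegral integral_poisson// mul1r hornerD hornerM hornerXn expr1
  mulr0 add0r hornerC.
Qed.

(** A pointwise limit of polynomials in the Cayley transform is measurable; this is how
    measurability of the shifted resolvents of F is obtained. *)
Lemma disc_alg_measurable h : disc_alg z h ->
  measurable_fun [set: R] (fun t : R => Im (h t%:C)).
Proof.
move=> hz.
have /choice[P hP] n : exists P : {poly R[i]}, forall w, 0 <= Im w ->
    `|h w - P.[cayley z w]| <= (n.+1%:R^-1)%:C.
  by apply: hz; rewrite invr_gt0 ltr0n.
apply: (measurable_fun_cvg (h := fun n (t : measurableTypeR R) =>
    Im (P n).[cayley z t%:C])) => [n|t _].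
  exact: measurable_Im_horner_cayley.
apply: (@cvg_dist_bound _ _ (fun n => n.+1%:R^-1)); last exact: cvg_harmonic.
near=> n; rewrite -ImB -lecR (le_trans (ler_normIm _))// hP//.
Unshelve. all: by end_near. Qed.

(** The error of a polynomial approximation is paid twice, once under the integral and once at [z].
    Imaginary parts suffice, since the Poisson kernels to be tested are imaginary parts of
    resolvents. *)
Lemma disc_alg_poisson h (M : R) : disc_alg z h ->
  (forall w : R[i], 0 <= Im w -> `|h w| <= M%:C) ->
  \int[leb]_t (poisson z t * Im (h t%:C)) = Im (h z).
Proof.
move=> hz hM; apply/eqP; rewrite -subr_eq0 -normr_le0; apply/ler_addgt0Pl => e e0.
rewrite addr0; have e20 : 0 < e / 2 by rewrite divr_gt0.
have [P hP] := hz _ e20.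
have mh := disc_alg_measurable hz.
have mP := measurable_Im_horner_cayley P.
have ih : leb.-integrable setT (EFin \o (fun t => poisson z t * Im (h t%:C))).
  apply: (@integrable_poissonM _ M) => // t.
  by rewrite -lecR (le_trans (ler_normIm _))// hM.
have iP : leb.-integrable setT
    (EFin \o (fun t => poisson z t * Im P.[cayley z t%:C])).
  have [N _ PN] := horner_bounded P.
  apply: (@integrable_poissonM _ N) => // t.
  by rewrite -lecR (le_trans (ler_normIm _))// PN// norm_cayley_real.
rewrite -(subrKA (Im P.[0])) (le_trans (ler_normD _ _))// [e]splitr lerD//.
  rewrite -Rintegral_poisson_horner -RintegralB//.
  under eq_Rintegral do rewrite -mulrBr -ImB.
  apply: norm_RintegralM_poisson.
    by under eq_fun do rewrite ImB; exact: measurable_funB.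
  by move=> t; rewrite -lecR (le_trans (ler_normIm _))// hP.
rewrite distrC -ImB -lecR (le_trans (ler_normIm _))//.
by rewrite -(cayleyxx z) hP// ltW.
Qed.

End poisson_formula.

(** * The boundary map and the Cauchy laws *)

Section F_transform_facts.
Context {R : realType}.
Variable mu : probability (measurableTypeR R) R.
Local Notation leb := (@lebesgue_measure R).
Local Notation G := (cauchy_transform mu).
Local Notation F := (F_transform mu).
Implicit Types (z w : R[i]) (x t : R).

Lemma F_transformE z : F z = (G z)^-1. Proof. by []. Qed.

Lemma Rintegral_prob_cst (c : R) : \int[mu]_t c = c.
Proof.
rewrite Rintegral_cst// [X in fine X](_ : _ = 1%E) ?mulr1//.
exact: probability_setT.
Qed.

Lemma cintegrable_cauchy_kernel z : 0 < Im z ->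
  cintegrable mu (fun t : measurableTypeR R => (z - t%:C)^-1).
Proof.
move=> z0; apply: (@cintegrable_bounded _ _ _ (Im z)^-1).
  exact: cmeasurable_cauchy_kernel.
by move=> t; exact: norm_cauchy_kernel_le.
Qed.

Let k z t : R[i] := (z - t%:C)^-1.
Let q z t : R := Re (k z t) ^+ 2 + Im (k z t) ^+ 2.

Let ImkE z t : Im (k z t) = - Im z * q z t.
Proof.
rewrite /q /k; set w := z - t%:C.
have -> : Im z = Im w by rewrite /w ImB /= subr0.
rewrite ImV ReV; set D := Re w ^+ 2 + Im w ^+ 2.
have [D0|D0] := eqVneq D 0; first by rewrite D0 invr0 !mulr0 expr0n !addr0 mulr0.
by congr (_ * _); rewrite !exprMn sqrrN -mulrDl -/D expr2 mulrA divff// mul1r.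
Qed.

Let integrable_q z : 0 < Im z -> mu.-integrable [set: measurableTypeR R] (EFin \o q z).
Proof.
move=> z0; have [_ i2] := cintegrable_cauchy_kernel z0.
have -> : EFin \o q z = (fun t => (- (Im z)^-1)%:E * (Im (k z t))%:E)%E.
  apply/funext => t /=; rewrite -EFinM ImkE; congr EFin.
  by rewrite mulrA mulrNN mulVf ?mul1r// gt_eqF.
exact: integrableZl.
Qed.

Let ImGE z : 0 < Im z -> Im (G z) = - Im z * \int[mu]_t q z t.
Proof.
move=> z0; rewrite /G/=; under eq_Rintegral do rewrite -/(k z _) ImkE.
by rewrite RintegralZl//; exact: integrable_q.
Qed.

(** The Cauchy-Schwarz inequality for the kernel [k z] against a probability: integrate
    [|k - G z| ^ 2 >= 0], written as a linear minorant of [|k| ^ 2]. *)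
Let sqr_normG_le z : 0 < Im z -> Re (G z) ^+ 2 + Im (G z) ^+ 2 <= \int[mu]_t q z t.
Proof.
move=> z0; have [i1 i2] := cintegrable_cauchy_kernel z0.
set A := Re (G z); set B := Im (G z).
have iA : mu.-integrable [set: measurableTypeR R] (EFin \o (fun t => (2 * A) * Re (k z t))).
  rewrite /comp; under eq_fun do rewrite EFinM; exact: integrableZl.
have iB : mu.-integrable [set: measurableTypeR R] (EFin \o (fun t => (2 * B) * Im (k z t))).
  rewrite /comp; under eq_fun do rewrite EFinM; exact: integrableZl.
have iC := integrable_prob_cst mu (A ^+ 2 + B ^+ 2).
have iAB : mu.-integrable [set: measurableTypeR R]
    (EFin \o (fun t => 2 * A * Re (k z t) + 2 * B * Im (k z t))).
  rewrite /comp; under eq_fun do rewrite EFinD; exact: integrableD.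
have iL : mu.-integrable [set: measurableTypeR R]
    (EFin \o (fun t => 2 * A * Re (k z t) + 2 * B * Im (k z t) - (A ^+ 2 + B ^+ 2))).
  rewrite /comp; under eq_fun do rewrite EFinB; exact: integrableB.
have := le_Rintegral measurableT iL (integrable_q z0) => h.
have -> : A ^+ 2 + B ^+ 2 = \int[mu]_t
    (2 * A * Re (k z t) + 2 * B * Im (k z t) - (A ^+ 2 + B ^+ 2)).
  rewrite RintegralB// RintegralD// !RintegralZl// Rintegral_prob_cst.
  rewrite -[\int[mu]_x Re (k z x)]/A -[\int[mu]_x Im (k z x)]/B; ring.
apply: h => t _; rewrite /q.
have := sqr_ge0 (Re (k z t) - A); have := sqr_ge0 (Im (k z t) - B).
rewrite !sqrrB; lra.
Qed.

(** The integrand is positive everywhere, so a zero integral would make the whole line a null set of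
    [mu]. *)
Let int_q_gt0 z : 0 < Im z -> 0 < \int[mu]_t q z t.
Proof.
move=> z0; rewrite lt_neqAle Rintegral_ge0 ?andbT; last first.
  by move=> t _; rewrite addr_ge0 ?sqr_ge0.
apply/eqP => /esym q0.
have iq := integrable_q z0.
have mq : measurable_fun [set: measurableTypeR R] (EFin \o q z) by exact: measurable_int iq.
have : (\int[mu]_t `|(EFin \o q z) t| = (\int[mu]_t q z t)%:E)%E.
  rewrite /Rintegral fineK; last exact: integrable_fin_num.
  by apply: eq_integral => t _; rewrite /= ger0_norm// addr_ge0 ?sqr_ge0.
rewrite q0 => /(ae_eq_integral_abs mu measurableT mq).1 [N [mN N0 sN]].
have : mu setT = 0%E.
  apply/eqP; rewrite eq_le measure_ge0 andbT -N0 le_measure ?inE//.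
  apply: subset_trans sN => t _ /= /(_ I) [] /eqP; apply/negP.
  have kn0 : k z t != 0 by rewrite invr_eq0 Im_neq0// ImB /= subr0 gt_eqF.
  rewrite /q paddr_eq0 ?sqr_ge0// !sqrf_eq0; apply: contra kn0 => /andP[/eqP a /eqP b].
  by apply/eqP/complexP.
by rewrite probability_setT => /eqP; rewrite onee_eq0.
Qed.

Lemma cauchy_transform_neq0 z : 0 < Im z -> G z != 0.
Proof.
move=> z0; apply: Im_neq0; rewrite ImGE//.
by rewrite mulf_neq0 ?oppr_eq0 ?gt_eqF ?int_q_gt0.
Qed.

(** [Im (F z)] is [- Im (G z) / |G z| ^ 2], that is [Im z] times the mean of [|z - t| ^ -2] divided
    by [|G z| ^ 2]; this ratio is at least 1 by [sqr_normG_le]. *)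
Lemma Im_F_transform_ge z : 0 < Im z -> Im z <= Im (F z).
Proof.
move=> z0; rewrite F_transformE ImV {1}ImGE// [- Im z * _]mulNr opprK.
rewrite ler_pdivlMr; first by apply: ler_wpM2l; [exact: ltW|exact: sqr_normG_le].
rewrite lt_neqAle addr_ge0 ?sqr_ge0// andbT eq_sym paddr_eq0 ?sqr_ge0//.
rewrite !sqrf_eq0; apply: contra (cauchy_transform_neq0 z0) => /andP[/eqP a /eqP b].
by apply/eqP/complexP.
Qed.

Lemma Im_F_transform_gt0 z : 0 < Im z -> 0 < Im (F z).
Proof. by move=> z0; rewrite (lt_le_trans z0)// Im_F_transform_ge. Qed.

Lemma norm_resolvent z w (y : R) : 0 < Im z -> Im w <= 0 -> 0 < y ->
  y <= Im z - Im w -> `|(F z - w)^-1| <= y^-1%:C.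
Proof.
move=> z0 w0 y0 yzw; apply: ler_normV_Im => //.
rewrite ImB (le_trans yzw)// (le_trans _ (ler_norm _))// lerD2r.
exact: Im_F_transform_ge.
Qed.

Lemma resolvent_neq0 z w : 0 < Im z -> Im w <= 0 -> F z - w != 0.
Proof.
move=> z0 w0; apply: Im_neq0; rewrite ImB gt_eqF// subr_gt0.
by rewrite (le_lt_trans w0)// Im_F_transform_gt0.
Qed.

End F_transform_facts.

(** If [h = 1 / (f - b)], then [h / (1 - c * h) = 1 / (f - b - c)]: the pole moves by [c]. The bound
    on [c] gives [|c * h| <= 1/2], as the geometric series requires. *)
Lemma disc_alg_resolvent_step {R : realType} (z c : R[i]) (h : R[i] -> R[i]) (M : R) :
  0 < M -> disc_alg z h -> (forall w : R[i], 0 <= Im w -> `|h w| <= M%:C) ->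
  `|c| <= (2 * M)^-1%:C -> disc_alg z (fun w => h w / (1 - c * h w)).
Proof.
move=> M0 zh hM cM.
have ch2 (w : R[i]) : 0 <= Im w -> `|c * h w| <= 2^-1%:C.
  move=> w0; rewrite normrM (le_trans (ler_pM _ _ cM (hM w w0)))//.
  by rewrite -realcM invfM divfK ?gt_eqF.
have zch : disc_alg z (fun w => c * h w).
  apply: (@disc_algM _ _ _ _ (M + (`|Re c| + `|Im c|))) => //.
  - by rewrite ltr_pwDl ?addr_ge0.
  - move=> w _; rewrite (le_trans (ler_normc_add c))// lecR lerDr ltW//.
  - by move=> w w0; rewrite (le_trans (hM w w0))// lecR lerDl addr_ge0.
  - exact: disc_alg_cst.
apply: (@disc_algM _ _ _ _ (M + 2)) => //.
- by rewrite addr_gt0.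
- by move=> w w0; rewrite (le_trans (hM w w0))// lecR lerDl.
- move=> w w0; have h1 : 2^-1%:C <= `|1 - c * h w|.
    rewrite (le_trans _ (lerB_dist _ _))// normr1 lerBrDr.
    have -> : 1 = 2^-1%:C + 2^-1%:C :> R[i].
      by rewrite -rmorphD/= -[LHS](rmorph1 (real_complex R)); congr (_%:C); lra.
    by rewrite lerD2l ch2.
  have h2 : 0 < 2^-1%:C :> R[i] by rewrite ltcR.
  rewrite normfV (@le_trans _ _ 2%:C)//; last by rewrite lecR lerDr ltW.
  rewrite -[2%:C]invrK lef_pV2 ?posrE ?(lt_le_trans h2)// -?fmorphV//.
- exact: disc_alg_geom.
Qed.

(** * Resolvents of F up to the boundary *)

Section boundary.
Context {R : realType}.
Variable mu : probability (measurableTypeR R) R.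
Local Notation leb := (@lebesgue_measure R).
Local Notation G := (cauchy_transform mu).
Local Notation F := (F_transform mu).
Implicit Types (a z w : R[i]) (x t : R).

Let shift_gt0 w (e : R) : 0 < e -> 0 <= Im w -> 0 < Im (w + 0 +i* e).
Proof. by move=> e0 w0; rewrite ImD /= ltr_wpDl. Qed.

Let norm_shift_resolvent a w (e : R) : 0 < e -> 0 <= Im w -> Im a <= 0 ->
  `|(F (w + 0 +i* e) - a)^-1| <= (e - Im a)^-1%:C.
Proof.
move=> e0 w0 a0; apply: norm_resolvent => //.
- exact: shift_gt0.
- by rewrite subr_gt0 (le_lt_trans a0).
- by rewrite lerD2r ImD /= lerDr.
Qed.

(* The pole is moved from 0 to [a] along a segment, in steps short enough for
   the resolvent identity to be inverted by a geometric series. *)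
Lemma disc_alg_resolvent z a (e : R) : 0 < Im z -> 0 < e -> Im a <= 0 ->
  disc_alg z (fun w => (F (w + 0 +i* e) - a)^-1).
Proof.
move=> z0 e0 a0.
pose C := `|Re a| + `|Im a|; have C0 : 0 <= C by rewrite addr_ge0.
(* All poles [b j] satisfy [Im (b j) <= 0], so their resolvents share the bound [e^-1] and one step
   length, at most [e / 2], serves the whole segment. *)
pose N := (Num.truncn (2 * C / e)).+1.
have N0 : 0 < N%:R :> R by rewrite ltr0n.
have CN : C / N%:R <= e / 2.
  rewrite ler_pdivrMr// -ler_pdivrMl ?divr_gt0// invf_div.
  by rewrite mulrAC ltW// truncnS_gt.
pose b j : R[i] := (j%:R / N%:R)%:C * a.
have b0 j : Im (b j) <= 0.
  by rewrite /b ImM /= mul0r addr0 mulr_ge0_le0// divr_ge0.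
suff H j : disc_alg z (fun w => (F (w + 0 +i* e) - b j)^-1).
  by have := H N; rewrite /b divff ?gt_eqF// mul1r.
elim: j => [|j IH].
  (* For the pole 0 the resolvent [1 / F] is the Cauchy transform itself. *)
  rewrite /b mul0r mul0r; under eq_fun do rewrite subr0 F_transformE invrK.
  exact: disc_alg_cauchy_transform.
have bS : b j.+1 = b j + N%:R^-1%:C * a.
  by rewrite /b -mulrDl -rmorphD/= -[j.+1%:R]natr1 [in LHS]mulrDl mul1r.
(* The resolvent identity is available on the closed half-plane only, so membership is transferred
   as a uniform limit with error 0. *)
apply: (@disc_alg_ulim _ _ _ _) => r r0.
exists (fun w => (F (w + 0 +i* e) - b j)^-1 /
    (1 - N%:R^-1%:C * a * (F (w + 0 +i* e) - b j)^-1)).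
  apply: (@disc_alg_resolvent_step _ _ _ _ e^-1) => //; first by rewrite invr_gt0.
    move=> w w0; rewrite (le_trans (norm_shift_resolvent _ _ _))// lecR.
    by have bj := b0 j; rewrite lef_pV2 ?posrE; lra.
  rewrite normrM normcR (le_trans (ler_wpM2l _ (ler_normc_add a))) ?ler0c//.
  rewrite -realcM lecR invfM invrK ger0_norm ?invr_ge0// mulrC.
  by rewrite (le_trans CN)// mulrC.
move=> w w0; have wp := shift_gt0 e0 w0.
have n1 := resolvent_neq0 mu wp (b0 j).
have n2 := resolvent_neq0 mu wp (b0 j.+1).
rewrite [X in `|X|](_ : _ = 0) ?normr0 ?ler0c ?ltW//.
rewrite bS in n2 *; apply/eqP; rewrite subr_eq0; apply/eqP.
set f := F _ in n1 n2 *; set c := _ * a in n2 *; clearbody f c.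
have n3 : f - b j - c != 0 by rewrite opprD addrA in n2.
set d := b j in n1 n3 *; clearbody d; field.
by rewrite n1 n3.
Qed.

Lemma poisson_resolvent_shift z a (e : R) : 0 < Im z -> 0 < e -> Im a <= 0 ->
  \int[leb]_t (poisson z t * Im (F (t +i* e) - a)^-1) = Im (F (z + 0 +i* e) - a)^-1.
Proof.
move=> z0 e0 a0.
have hb w (w0 : 0 <= Im w) := norm_shift_resolvent e0 w0 a0.
rewrite -(disc_alg_poisson z0 (disc_alg_resolvent z0 e0 a0) hb).
by under [RHS]eq_Rintegral do rewrite realcD_Im.
Qed.

Lemma measurable_resolvent_shift a (e : R) : 0 < e -> Im a <= 0 ->
  measurable_fun [set: R] (fun t => Im (F (t +i* e) - a)^-1).
Proof.
move=> e0 a0.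
have i0 : 0 < Im ('i : R[i]) by rewrite /= ltr01.
have := disc_alg_measurable (disc_alg_resolvent i0 e0 a0).
by under eq_fun do rewrite realcD_Im.
Qed.

Lemma norm_cauchy_transform_shift z (e : R) : 0 < Im z -> 0 < e ->
  `|G (z + 0 +i* e) - G z| <= (2 * (e / Im z ^+ 2))%:C.
Proof.
move=> z0 e0; have zp := shift_gt0 e0 (ltW z0).
rewrite -cintegralB; [|exact: cintegrable_cauchy_kernel..].
have := @ler_norm_cintegral _ _ _ mu
  (fun t : measurableTypeR R => (z + 0 +i* e - t%:C)^-1 - (z - t%:C)^-1)
  (cst (e / Im z ^+ 2)).
rewrite Rintegral_prob_cst; apply.
- by apply: cmeasurableB; exact: cmeasurable_cauchy_kernel.
- exact: integrable_prob_cst.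
move=> t /=.
have n1 : z - t%:C != 0 by apply: Im_neq0; rewrite ImB /= subr0 gt_eqF.
have n2 : z + 0 +i* e - t%:C != 0 by apply: Im_neq0; rewrite ImB /= subr0 gt_eqF.
have -> : (z + 0 +i* e - t%:C)^-1 - (z - t%:C)^-1 =
    - (0 +i* e) * ((z + 0 +i* e - t%:C)^-1 * (z - t%:C)^-1).
  by field; rewrite n1 n2.
rewrite normrM normrN realcM ler_pM//.
  by rewrite (le_trans (ler_normc_add _))// lecR /= normr0 add0r gtr0_norm.
rewrite normrM expr2 invfM realcM ler_pM ?norm_cauchy_kernel_le//.
rewrite (le_trans (norm_cauchy_kernel_le _ _))// lecR lef_pV2 ?posrE//.
by rewrite ImD /= lerDl ltW.
Qed.

End boundary.

(** Dominated convergence is applied along a sequence, so the limit at [0^'+] is sampled at the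
    heights [1 / (n + 1)]. *)
Lemma near_at_right_harmonic {R : realType} (P : R -> Prop) :
  (\forall y \near 0^'+, P y) -> \forall n \near \oo, P n.+1%:R^-1.
Proof.
move=> hP; have /cvgrPdist_lt hc := @cvg_harmonic R.
move: hP; rewrite /at_right/= => -[e /= e0 he].
have := hc _ e0; by apply: filterS => n hn; exact: he.
Qed.

Section boundary_poisson.
Context {R : realType}.
Variable mu : probability (measurableTypeR R) R.
Local Notation leb := (@lebesgue_measure R).
Local Notation G := (cauchy_transform mu).
Local Notation F := (F_transform mu).
Variable T : R -> R.
Hypothesis bT : is_boundary_map mu T.
Implicit Types (a z w : R[i]) (x t : R).

Lemma cvg_resolvent_shift z a : 0 < Im z -> Im a <= 0 ->
  Im (F (z + 0 +i* n.+1%:R^-1) - a)^-1 @[n --> \oo] --> Im (F z - a)^-1.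
Proof.
move=> z0 a0.
pose C := `|Re a| + `|Im a|; have C0 : 0 <= C by rewrite addr_ge0.
pose D := (1 + C * (Im z)^-1) ^+ 2 * (2 * (Im z ^+ 2)^-1).
apply: (@cvg_dist_bound _ _ (fun n => D * n.+1%:R^-1)); last first.
  rewrite -[X in _ --> X](mulr0 D).
  by apply: cvgM; [exact: cvg_cst|exact: cvg_harmonic].
apply: nearW => n; rewrite -ImB -lecR (le_trans (ler_normIm _))//.
set e := n.+1%:R^-1; have e0 : 0 < e by rewrite invr_gt0.
set zn := z + _; have zn0 : Im z <= Im zn by rewrite ImD /= lerDl ltW.
have zn0' : 0 < Im zn by rewrite (lt_le_trans z0).
have g0 := cauchy_transform_neq0 mu z0; have gn0 := cauchy_transform_neq0 mu zn0'.
have f0 := resolvent_neq0 mu z0 a0; have fn0 := resolvent_neq0 mu zn0' a0.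
(* The difference is expressed through the increment of [G = 1 / F], which is under control; the
   factors [F / (F - a) = 1 + a / (F - a)] are bounded because the resolvents are. *)
have -> : (F z - a)^-1 - (F zn - a)^-1 =
    - (G zn - G z) * ((1 + a * (F z - a)^-1) * (1 + a * (F zn - a)^-1)).
  have -> : 1 + a * (F z - a)^-1 = F z * (F z - a)^-1 by field; rewrite f0.
  have -> : 1 + a * (F zn - a)^-1 = F zn * (F zn - a)^-1 by field; rewrite fn0.
  have h (b : R[i]) : F b = (G b)^-1 by [].
  rewrite !h in f0 fn0 *.
  set x := G z in g0 f0 *; set y := G zn in gn0 fn0 *; clearbody x y.
  have h1 (b : R[i]) : b != 0 -> b^-1 - a != 0 -> 1 - a * b != 0.
    move=> b0; apply: contra; rewrite !subr_eq0 => /eqP ab.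
    by apply/eqP/(mulIf b0); rewrite mulVf.
  have h2 := h1 _ g0 f0; have h3 := h1 _ gn0 fn0.
  by field; rewrite !mulNr g0 gn0 h2 h3.
have B b : 0 < Im b -> Im z <= Im b -> `|1 + a * (F b - a)^-1| <= (1 + C * (Im z)^-1)%:C.
  move=> b0 zb; rewrite (le_trans (ler_normD _ _))// normr1 realcD lerD2l.
  rewrite normrM realcM ler_pM ?ler_normc_add// norm_resolvent//.
  by rewrite (le_trans zb)// lerDl oppr_ge0.
rewrite normrM normrN normrM /D -mulrA [_ * (2 * _ * _)]mulrC realcM.
rewrite ler_pM//.
  rewrite (le_trans (norm_cauchy_transform_shift _ _ _))// lecR -mulrA.
  by rewrite [_^-1 * e]mulrC.
by rewrite expr2 realcM ler_pM ?B.
Qed.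

Lemma measurable_boundary_resolvent a :
  measurable_fun [set: R] (fun t => Im ((T t)%:C - a)^-1).
Proof.
have mT : measurable_fun [set: measurableTypeR R] (T : R -> R) by case: bT.
have [] // := @cmeasurableV _ (measurableTypeR R) R (fun t => (T t)%:C - a).
by apply: cmeasurableB; [exact: cmeasurableC|exact: cmeasurable_cst].
Qed.

(** The limit [T t] is real, so [Im a < 0] must be strict: then [v |-> 1 / (v - a)] is Lipschitz on
    the closed upper half-plane with constant [(Im a) ^ -2], and convergence of F passes to its
    resolvents. *)
Lemma ae_cvg_boundary_resolvent a : Im a < 0 ->
  {ae leb, forall t, Im (F (t +i* n.+1%:R^-1) - a)^-1 @[n --> \oo] -->
    Im ((T t)%:C - a)^-1}.
Proof.
move=> a0; case: bT => _; apply: filterS; first exact: (ae_filter_ringOfSetsType leb).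
move=> t Tt.
pose y := - Im a; have y0 : 0 < y by rewrite oppr_gt0.
apply/cvgrPdist_le => e e0.
have d0 : 0 < (e * y ^+ 2)%:C :> R[i] by rewrite ltcR mulr_gt0// exprn_gt0.
have /(_ _) := (@cvgrPdist_lt R[i] R[i]^o _ _ _ _ _).1 Tt _ d0.
move=> /near_at_right_harmonic; apply: filterS => n hn.
rewrite -ImB -lecR (le_trans (ler_normIm _))//.
set w := t +i* _ in hn *.
have w0 : 0 < Im w by rewrite /= invr_gt0.
have n1 : `|(F w - a)^-1| <= y^-1%:C.
  by apply: norm_resolvent => //; [exact: ltW|rewrite lerDr ltW].
have n2 : `|((T t)%:C - a)^-1| <= y^-1%:C.
  by apply: ler_normV_Im => //; rewrite ImB /= sub0r ler_norm.
have f1 := resolvent_neq0 mu w0 (ltW a0).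
have f2 : (T t)%:C - a != 0 by apply: Im_neq0; rewrite ImB /= sub0r gt_eqF.
have -> : ((T t)%:C - a)^-1 - (F w - a)^-1 =
    - ((T t)%:C - F w) * (((T t)%:C - a)^-1 * (F w - a)^-1).
  by field; rewrite f1 f2.
have -> : e = (e * y ^+ 2) * (y^-1 * y^-1) by field; rewrite gt_eqF.
rewrite normrM normrN [X in _ <= X]realcM ler_pM//; first exact: ltW.
by rewrite normrM realcM ler_pM.
Qed.

(** The shift in [poisson_resolvent_shift] is sent to 0. On the left the resolvents are bounded by
    [(- Im a)^-1] and the Poisson kernel is integrable; on the right [cvg_resolvent_shift]
    applies. *)
Lemma boundary_poisson z a : 0 < Im z -> Im a < 0 ->
  \int[leb]_t (poisson z t * Im ((T t)%:C - a)^-1) = Im (F z - a)^-1.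
Proof.
move=> z0 a0.
have e0 n : 0 < n.+1%:R^-1 :> R by rewrite invr_gt0.
pose f n t := poisson z t * Im (F (t +i* n.+1%:R^-1) - a)^-1.
have c1 : \int[leb]_t f n t @[n --> \oo] -->
    \int[leb]_t (poisson z t * Im ((T t)%:C - a)^-1).
  apply: (@Rintegral_dominated_cvg _ (measurableTypeR R) R leb f _
      (fun t => poisson z t * (- Im a)^-1)).
  - move=> n; apply: measurable_funM; first exact: measurable_poisson.
    by apply: measurable_resolvent_shift => //; exact: ltW.
  - apply: measurable_funM; first exact: measurable_poisson.
    exact: measurable_boundary_resolvent.
  - have := ae_cvg_boundary_resolvent a0.
    apply: filterS; first exact: (ae_filter_ringOfSetsType leb).
    move=> t ht.
    by apply: cvgM => //; exact: cvg_cst.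
  - apply: (@integrable_poissonM _ _ _ _ `|(- Im a)^-1|) => //.
  - move=> n t; rewrite /f normrM (ger0_norm (poisson_ge0 z0 t)).
    rewrite ler_wpM2l ?poisson_ge0// -lecR (le_trans (ler_normIm _))//.
    apply: norm_resolvent; rewrite /= ?oppr_gt0//; first exact: ltW.
    by rewrite lerDr ltW.
have c2 : \int[leb]_t f n t @[n --> \oo] --> Im (F z - a)^-1.
  have -> : (fun n => \int[leb]_t f n t) =
      (fun n => Im (F (z + 0 +i* n.+1%:R^-1) - a)^-1).
    by apply/funext => n; rewrite /f poisson_resolvent_shift// ltW.
  by apply: cvg_resolvent_shift => //; exact: ltW.
exact: (cvg_unique _ c1 c2).
Qed.

End boundary_poisson.

(** * Cauchy laws as probability measures, and uniqueness from Poisson integrals *)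

Definition poisson_prob {R : realType} (z : R[i]) of 0 < Im z :=
  fun A : set (measurableTypeR R) =>
    (\int[lebesgue_measure]_(t in A) (poisson z t)%:E)%E.

Section poisson_prob.
Context {R : realType}.
Local Notation leb := (@lebesgue_measure R).
Variable z : R[i].
Hypothesis z0 : 0 < Im z.

Local Notation P := (poisson_prob z0).

Let poisson_prob0 : P set0 = 0%E.
Proof. by rewrite /poisson_prob integral_set0. Qed.

Let poisson_prob_ge0 A : (0 <= P A)%E.
Proof. by apply: integral_ge0 => t _; rewrite lee_fin poisson_ge0. Qed.

Let measurable_poissonE (D : set (measurableTypeR R)) :
  measurable_fun D (EFin \o poisson z).
Proof. by apply/measurable_EFinP/measurable_funTS; exact: measurable_poisson. Qed.

Let poisson_prob_sigma_additive : semi_sigma_additive P.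
Proof.
move=> /= F mF tF mUF; rewrite /poisson_prob; apply: cvg_toP.
  apply: ereal_nondecreasing_is_cvgn => m n mn.
  apply: lee_sum_nneg_natr => // k _ _; apply: integral_ge0 => /= t _.
  by rewrite lee_fin poisson_ge0.
rewrite ge0_integral_bigcup//=.
by move=> t _; rewrite lee_fin poisson_ge0.
Qed.

HB.instance Definition _ := isMeasure.Build _ _ _
  P poisson_prob0 poisson_prob_ge0 poisson_prob_sigma_additive.

Let poisson_prob_setT : P [set: _] = 1%E.
Proof. by rewrite /poisson_prob integral_poisson. Qed.

HB.instance Definition _ := @Measure_isProbability.Build _ _ R P poisson_prob_setT.

Lemma poisson_prob_dominates : P `<< leb.
Proof.
apply/null_content_dominatesP => A mA A0.
exact: null_set_integral.
Qed.

(** The change of density uses the Radon-Nikodym derivative, which agrees almost everywhere with the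
    Poisson kernel since both have the same integral over every measurable set. *)
Lemma integral_poisson_prob (f : R -> \bar R) :
  P.-integrable [set: measurableTypeR R] f ->
  (\int[P]_t f t = \int[leb]_t (f t * (poisson z t)%:E))%E.
Proof.
move=> intf; have mf := measurable_int _ intf.
rewrite -(Radon_Nikodym_change_of_variables poisson_prob_dominates)//=.
apply: ae_eq_integral => //.
- apply: emeasurable_funM => //; apply: (measurable_int leb).
  by apply: Radon_Nikodym_integrable; exact: poisson_prob_dominates.
- exact: emeasurable_funM.
- apply: ae_eqe_mul2l => /=.
  rewrite Radon_NikodymE//=; first exact: poisson_prob_dominates.
  move=> abmu; case: cid => /= h [h1 h2 h3].
  by apply: integral_ae_eq => //= E E01 mE; rewrite -h3.
Qed.

End poisson_prob.

Section poisson_uniqueness.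
Context {R : realType}.
Local Notation leb := (@lebesgue_measure R).
Implicit Types (x y s : R).

(** This turns identities for resolvents with pole [conjc z], below the axis, into identities for
    Poisson integrals. *)
Lemma poissonE (z : R[i]) s : 0 < Im z ->
  poisson z s = - pi^-1 * Im (s%:C - conjc z)^-1.
Proof.
move=> z0; rewrite ImV ReB ImB Re_conjc Im_conjc /= sub0r opprK mulrA mulrNN.
by rewrite /poisson opprK invfM mulrCA mulrA.
Qed.

Lemma poissonC x y s : poisson (x +i* y) s = poisson (s +i* y) x.
Proof. by rewrite /poisson /= -[x - s]opprB sqrrN. Qed.

Lemma measurable_poisson2 y : 0 < y ->
  measurable_fun [set: measurableTypeR R * measurableTypeR R]
    (fun q => poisson (q.1 +i* y) q.2).
Proof.
move=> y0.
have -> : (fun q : measurableTypeR R * measurableTypeR R =>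
    poisson (q.1 +i* y) q.2) =
    (fun q => - pi^-1 * Im ((q.2)%:C - ((q.1)%:C - 0 +i* y))^-1).
  apply/funext => q; rewrite poissonE//; congr (_ * Im (_ - _)^-1).
  by apply: complexP; rewrite ?ReB ?ImB /= ?subr0 ?sub0r.
apply: measurable_funM; first exact: measurable_cst.
have [] // := @cmeasurableV _ (measurableTypeR R * measurableTypeR R)%type R
  (fun q => (q.2)%:C - ((q.1)%:C - 0 +i* y)).
apply: cmeasurableB.
  by apply: cmeasurableC; exact: measurable_snd.
apply: cmeasurableB; last exact: cmeasurable_cst.
by apply: cmeasurableC; exact: measurable_fst.
Qed.

(* The Poisson kernel at height 1 / n^2 integrated over an interval shifted by
   1 / n: the shift beats the height, so that the limit is the indicator of
   [`]a, b]] also at the end points. *)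
Let half_line_approx (n : nat) (u : R) : R :=
  pi^-1 * atan ((u + n.+1%:R^-1) / (n.+1%:R^-1 ^+ 2)).

Let cvg_half_line_approx (u : R) :
  half_line_approx n u @[n --> \oo] --> (if 0 <= u then 2^-1 else - 2^-1 : R).
Proof.
have pi0 : pi != 0 :> R by rewrite gt_eqF ?pi_gt0.
(* In this form the limit is visible: the argument goes to minus infinity if [u < 0] and to plus
   infinity if [u >= 0]; at [u = 0] it is [n + 1], thanks to the shift. *)
have e (n : nat) : (u + n.+1%:R^-1) / (n.+1%:R^-1 ^+ 2) =
    n.+1%:R * (u * n.+1%:R + 1) :> R.
  by field; rewrite addrC natr1 pnatr_eq0.
have lim (f : nat -> R) : f n @[n --> \oo] --> +oo ->
    pi^-1 * atan (f n) @[n --> \oo] --> (2^-1 : R).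
  move=> foo; have -> : 2^-1 = pi^-1 * (pi / 2) :> R by rewrite mulKf.
  apply: cvgM; first exact: cvg_cst.
  by apply: (@cvg_comp _ _ _ f atan _ +oo); last exact: cvgy_atan.
rewrite /half_line_approx; under eq_fun do rewrite e.
case: ifPn => [u0|]; [|rewrite -ltNge => u0].
  apply: lim; apply/cvgryPge => A; near=> n.
  rewrite (@le_trans _ _ n.+1%:R)//.
    rewrite (@le_trans _ _ n%:R) ?ler_nat//.
    by near: n; exact: nbhs_infty_ger.
  by rewrite ler_peMr// lerDr mulr_ge0.
have -> : (fun n : nat => pi^-1 * atan (n.+1%:R * (u * n.+1%:R + 1))) =
    (fun n : nat => - (pi^-1 * atan (n.+1%:R * (- u * n.+1%:R - 1)))) :> (nat -> R).
  by apply/funext => n; rewrite -mulrN -atanN; congr (_ * atan _); ring.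
apply: cvgN; apply: lim; apply/cvgryPge => A; near=> n.
have n2 : 2 <= - u * n.+1%:R.
  rewrite mulrC -ler_pdivrMr ?oppr_gt0// (@le_trans _ _ n%:R) ?ler_nat//.
  by near: n; exact: nbhs_infty_ger.
rewrite (@le_trans _ _ n.+1%:R)//.
  rewrite (@le_trans _ _ n%:R) ?ler_nat//.
  by near: n; exact: nbhs_infty_ger.
by rewrite ler_peMr// lerBrDr.
Unshelve. all: by end_near. Qed.

Let itv_approx (a b : R) (n : nat) (s : R) : R :=
  half_line_approx n (b - s) - half_line_approx n (a - s).

Let shift_itv (a b : R) (n : nat) : set R :=
  `[a + n.+1%:R^-1, b + n.+1%:R^-1]%classic.

Let itv_approxE a b n s : a < b ->
  (\int[leb]_(x in shift_itv a b n)
     (poisson (x +i* (n.+1%:R^-1 ^+ 2)%R) s)%:E = (itv_approx a b n s)%:E)%E.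
Proof.
move=> ab; under eq_integral do rewrite poissonC.
have y0 : 0 < n.+1%:R^-1 ^+ 2 :> R by rewrite exprn_gt0// invr_gt0.
pose z := s +i* (n.+1%:R^-1 ^+ 2); have z0 : 0 < Im z by [].
have ab' : a + n.+1%:R^-1 < b + n.+1%:R^-1 by rewrite ltrD2r.
rewrite (is_derive_FTC ab' (continuous_poisson z0) (is_derive_poisson z0)).
by congr ((_ - _)%:E); rewrite /poisson_primitive /half_line_approx /=;
  congr (_ * atan (_ / _)); ring.
Qed.

Let cvg_itv_approx a b s : a < b ->
  itv_approx a b n s @[n --> \oo] --> (\1_(`]a, b]%classic) s : R).
Proof.
move=> ab.
have -> : \1_(`]a, b]%classic) s =
    (if 0 <= b - s then 2^-1 else - 2^-1) -
    (if 0 <= a - s then 2^-1 else - 2^-1) :> R.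
  rewrite indicE mem_setE in_itv/= !subr_ge0.
  by case: (leP s b) => sb; case: (leP s a) => sa /=; lra.
by apply: cvgB; exact: cvg_half_line_approx.
Qed.

Let norm_itv_approx a b n s : `|itv_approx a b n s| <= 1.
Proof.
rewrite /itv_approx /half_line_approx -mulrBr normrM gtr0_norm ?invr_gt0 ?pi_gt0//.
rewrite ler_pdivrMl ?pi_gt0// mulr1.
set u := _ / _; set v := _ / _.
have := atan_gtNpi2 u; have := atan_ltpi2 u.
have := atan_gtNpi2 v; have := atan_ltpi2 v.
by rewrite ler_norml => ? ? ? ?; apply/andP; split; lra.
Qed.

Let measurable_itv_approx a b n : a < b ->
  measurable_fun [set: measurableTypeR R] (itv_approx a b n).
Proof.
move=> ab.
have h (c : R) : measurable_fun [set: measurableTypeR R]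
    (fun s : R => half_line_approx n (c - s)).
  apply: measurable_funM; first exact: measurable_cst.
  apply: (measurableT_comp (f := atan)).
    by apply: continuous_measurable_fun; exact: continuous_atan.
  apply: measurable_funM; last exact: measurable_cst.
  apply: measurable_funD; last exact: measurable_cst.
  by apply: measurable_funB; [exact: measurable_cst|exact: measurable_id].
by apply: measurable_funB; exact: h.
Qed.

Let tonelli_itv_approx (m : probability (measurableTypeR R) R) a b n : a < b ->
  (\int[leb]_(x in shift_itv a b n)
     \int[m]_s (poisson (x +i* (n.+1%:R^-1 ^+ 2)%R) s)%:E =
   \int[m]_s (itv_approx a b n s)%:E)%E.
Proof.
move=> ab; set I := shift_itv a b n.
have y0 : 0 < n.+1%:R^-1 ^+ 2 :> R by rewrite exprn_gt0// invr_gt0.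
set y := n.+1%:R^-1 ^+ 2 in y0 *.
pose f (q : measurableTypeR R * measurableTypeR R) : \bar R :=
  (poisson (q.1 +i* y) q.2 * \1_I q.1)%:E.
have mf : measurable_fun setT f.
  apply/measurable_EFinP; apply: measurable_funM; first exact: measurable_poisson2.
  have mI : measurable (I : set (measurableTypeR R)) by exact: measurable_itv.
  apply: (measurableT_comp (f := \1_I : measurableTypeR R -> R)).
    exact: measurable_indic.
  exact: measurable_fst.
have f0 q : (0 <= f q)%E by rewrite lee_fin mulr_ge0 ?poisson_ge0.
have := @fubini_tonelli _ _ (measurableTypeR R) (measurableTypeR R) R leb m f mf f0.
move=> h; transitivity (\int[leb]_x \int[m]_s f (x, s))%E.
  rewrite [LHS]integral_mkcond; apply: eq_integral => x _; rewrite patchE; case: ifPn => xI.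
    by apply: eq_integral => s _; rewrite /f /= indicE xI mulr1.
  by rewrite integral0_eq// => s _; rewrite /f /= indicE (negbTE xI) mulr0.
rewrite h; apply: eq_integral => s _.
rewrite -itv_approxE// [RHS]integral_mkcond; apply: eq_integral => x _.
rewrite patchE /f/= indicE; case: ifPn => xI; first by rewrite mulr1.
by rewrite mulr0.
Qed.

(** Stieltjes inversion: by Tonelli, integrating the Poisson integrals over the shifted intervals
    gives the mean of [itv_approx], which converges to the mass of []a, b]]. These intervals are
    stable under intersection and generate the Borel sets. *)
Lemma poisson_unique (m1 m2 : probability (measurableTypeR R) R) :
  (forall z : R[i], 0 < Im z ->
    (\int[m1]_s (poisson z s)%:E = \int[m2]_s (poisson z s)%:E)%E) ->
  forall A, measurable A -> m1 A = m2 A.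
Proof.
move=> m12 A mA.
have cvgI (m : probability (measurableTypeR R) R) a b : a < b ->
    \int[m]_s (itv_approx a b n s) @[n --> \oo] --> fine (m `]a, b]%classic).
  move=> ab; have mI : measurable (`]a, b]%classic : set (measurableTypeR R)).
    exact: measurable_itv.
  have <- : \int[m]_s (\1_(`]a, b]%classic) s : R) = fine (m `]a, b]%classic).
    by rewrite /Rintegral integral_indic ?setIT.
  apply: (@Rintegral_dominated_cvg _ (measurableTypeR R) R m _ _ (cst 1)).
  - by move=> n; exact: measurable_itv_approx.
  - exact: measurable_indic.
  - by apply: aeW => s; exact: cvg_itv_approx.
  - exact: integrable_prob_cst.
  - by move=> n s; exact: norm_itv_approx.
have eqI a b : m1 `]a, b]%classic = m2 `]a, b]%classic.
  have [ab|ba] := ltP a b; last by rewrite set_itv_ge ?measure0// bnd_simp -leNgt.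
  have fin (m : probability (measurableTypeR R) R) : m `]a, b]%classic \is a fin_num.
    by rewrite fin_num_measure//; exact: measurable_itv.
  rewrite -[LHS]fineK// -[RHS]fineK//; congr EFin.
  have c1 := cvgI m1 a b ab; have c2 := cvgI m2 a b ab.
  apply: (cvg_unique _ c1) => //.
  rewrite (_ : (fun n => _) = (fun n => \int[m2]_s itv_approx a b n s))//.
  apply/funext => n; rewrite /Rintegral -!tonelli_itv_approx//.
  congr fine; apply: eq_integral => x _; apply: m12 => /=.
  by rewrite exprn_gt0// invr_gt0.
apply: (@measure_unique _ R (measurableTypeR R) (@ocitv R)
  (fun n => `](- n.+1%:R), n.+1%:R]%classic) _ _ _ _ m1 m2) => //.
- exact: ocitvI.
- by move=> n; exact: is_ocitv.
- apply/seteqP; split => // x _; exists (Num.truncn `|x|) => //=.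
  by have := truncnS_gt `|x|; rewrite in_itv/= ltr_norml => /andP[-> /ltW ->].
- by move=> _ [[a b] _ <-] /=; exact: eqI.
- by move=> n; rewrite -ge0_fin_numE// fin_num_measure//; exact: measurable_itv.
Qed.

End poisson_uniqueness.

(** * Essentially bounded test functions and the transport of Cauchy laws *)

Section essentially_bounded.
Context {R : realType}.
Local Notation leb := (@lebesgue_measure R).

Lemma lebesgue_measure_setT_gt0 : (0 < leb [set: R])%E.
Proof.
apply: (@lt_le_trans _ _ (leb `[0%R, 1%R]%classic)).
  by rewrite lebesgue_measure_itv/= lte_fin ltr01 sube0 lte_fin ltr01.
apply: le_measure; rewrite ?inE//; exact: measurable_itv.
Qed.

Lemma Lfun_oo_bounded (g : R -> R) : g \in Lfun leb +oo%E ->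
  measurable_fun [set: R] g /\
  exists M : R, {ae leb, forall t, `|g t| <= M}.
Proof.
rewrite inE => /andP[/[!inE]/= mg]; rewrite /finite_norm unlock /Lnorm.
rewrite lebesgue_measure_setT_gt0 => goo; split => //.
exact: (@ess_supr_bounded _ _ _ leb (fun t => `|g t|)).
Qed.

Lemma bounded_Lfun_oo (g : R -> R) (M : R) : measurable_fun [set: R] g ->
  (forall t, `|g t| <= M) -> g \in Lfun leb +oo%E.
Proof.
move=> mg gM; rewrite inE; apply/andP; split; rewrite inE//= /finite_norm.
rewrite unlock /Lnorm; case: ifPn => _; last exact: ltry.
apply: (@le_lt_trans _ _ M%:E); last exact: ltry.
by apply: (@ess_sup_ler _ _ _ leb (fun t => `|g t|)) => t; rewrite lee_fin.
Qed.

(** Testing against indicators gives equal integrals over all measurable sets. This makes the dual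
    condition in [perron_frobenius] determine its solution almost everywhere. *)
Lemma Lfun1_ae_eq (h1 h2 : R -> R) : h1 \in Lfun leb 1%E -> h2 \in Lfun leb 1%E ->
  (forall g, g \in Lfun leb +oo%E ->
    \int[leb]_t (h1 t * g t) = \int[leb]_t (h2 t * g t)) ->
  {ae leb, forall t, h1 t = h2 t}.
Proof.
move=> /Lfun1_integrable i1 /Lfun1_integrable i2 h12.
have : ae_eq leb setT (EFin \o h1) (EFin \o h2).
  apply: integral_ae_eq => //; first exact: measurable_int i2.
  move=> E _ mE.
  have iE (h : R -> R) : leb.-integrable setT (EFin \o h) ->
      (\int[leb]_(t in E) (EFin \o h) t = (\int[leb]_t (h t * \1_E t))%:E)%E.
    move=> ih; rewrite /Rintegral fineK.
      rewrite [LHS]integral_mkcond; apply: eq_integral => t _.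
      by rewrite patchE indicE /=; case: ifPn => _; rewrite ?mulr1 ?mulr0.
    apply: (integrable_fin_num measurableT).
    rewrite (_ : (fun t => _) = (EFin \o h) \_ E).
      by apply/(integrable_mkcond _ mE).1; exact: integrableS ih.
    by apply/funext => t; rewrite patchE indicE /=; case: ifPn => _; rewrite ?mulr1 ?mulr0.
  rewrite !iE// h12//; apply: (@bounded_Lfun_oo _ 1).
    exact: measurable_indic.
  by move=> t; rewrite indicE; case: (_ \in _); rewrite ?normr1 ?normr0.
move=> [N [mN N0 sN]]; exists N; split => //; apply: subset_trans sN => t /=.
by apply: contra_not => /(_ I) [].
Qed.

End essentially_bounded.

Section transport.
Context {R : realType}.
Variable mu : probability (measurableTypeR R) R.
Local Notation leb := (@lebesgue_measure R).
Local Notation F := (F_transform mu).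
Variable T : R -> R.
Hypothesis bT : is_boundary_map mu T.

Let mT : measurable_fun [set: measurableTypeR R] (T : measurableTypeR R -> measurableTypeR R).
Proof. by case: bT. Qed.

Let T_mixin := isMeasurableFun.Build _ _ (measurableTypeR R) (measurableTypeR R) T mT.
Let T_mfun : {mfun measurableTypeR R >-> measurableTypeR R} := HB.pack T T_mixin.

Lemma bounded_integrable_prob (P : probability (measurableTypeR R) R)
    (g : measurableTypeR R -> R) (M : R) :
  measurable_fun [set: measurableTypeR R] g -> {ae P, forall t, `|g t| <= M} ->
  P.-integrable [set: measurableTypeR R] (EFin \o g).
Proof.
move=> mg gM; apply/integrableP; split; first exact/measurable_EFinP.
apply: (@le_lt_trans _ _ (`|M|%:E * P setT)%E).
  apply: integral_le_bound => //; first exact/measurable_EFinP.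
  apply: filterS gM => t tM _ /=; rewrite lee_fin (le_trans tM)//.
  exact: ler_norm.
by rewrite lte_mul_pinfty// -ge0_fin_numE// fin_num_measure.
Qed.

Variable z : R[i].
Hypothesis z0 : 0 < Im z.
Let Fz0 := Im_F_transform_gt0 mu z0.

Let integral_poisson_probR (w : R[i]) (w0 : 0 < Im w) (g : R -> R) :
  (poisson_prob w0).-integrable [set: measurableTypeR R] (EFin \o g) ->
  \int[poisson_prob w0]_t g t = \int[leb]_t (poisson w t * g t).
Proof.
move=> ig; rewrite /Rintegral (integral_poisson_prob ig).
by congr fine; apply: eq_integral => t _; rewrite /= -EFinM mulrC.
Qed.

(** Both laws have the same Poisson integral at every [w]: up to [- pi^-1] it is
    [Im (F z - conjc w)^-1], on the left by [boundary_poisson], on the right by Poisson's formula at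
    the point [F z] for the Cauchy kernel with pole [conjc w]. *)
Lemma distribution_boundary (A : set (measurableTypeR R)) : measurable A ->
  distribution (poisson_prob z0) T_mfun A = poisson_prob Fz0 A.
Proof.
apply: poisson_unique => w w0.
have mw : measurable_fun [set: measurableTypeR R] (EFin \o poisson w).
  by apply/measurable_EFinP; exact: measurable_poisson.
have wb t : `|poisson w t| <= (pi * Im w)^-1.
  rewrite ger0_norm ?poisson_ge0// /poisson ler_pdivrMr ?mulr_gt0 ?pi_gt0 ?sqr_dist_gt0//.
  have pi0 := pi_gt0 R.
  rewrite invfM [X in _ <= X]mulrACA mulVf ?gt_eqF// mul1r mulrDr expr2 mulKf ?gt_eqF//.
  by rewrite lerDr mulr_ge0 ?sqr_ge0// invr_ge0 ltW.
have iP (P : probability (measurableTypeR R) R) (f : measurableTypeR R -> measurableTypeR R) :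
    measurable_fun [set: measurableTypeR R] f ->
    P.-integrable [set: measurableTypeR R] (EFin \o (poisson w \o f)).
  move=> mf; apply: (@bounded_integrable_prob _ _ (pi * Im w)^-1).
    by apply: measurableT_comp => //; exact: measurable_poisson.
  by apply: aeW => t; exact: wb.
rewrite ge0_integral_pushforward//; last by move=> t _; rewrite lee_fin poisson_ge0.
rewrite preimage_setT.
have i1 := iP (poisson_prob z0) T mT.
have i2 := iP (poisson_prob Fz0) id (@measurable_id _ _ _).
rewrite -[LHS]fineK; last exact: (integrable_fin_num measurableT i1).
rewrite -[RHS]fineK; last exact: (integrable_fin_num measurableT i2).
congr EFin.
have := integral_poisson_probR i1; rewrite /Rintegral => ->.
have := integral_poisson_probR i2; rewrite /Rintegral => ->.
have a0 : Im (conjc w) < 0 by rewrite Im_conjc oppr_lt0.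
pose k (v : R[i]) : R[i] := (v - conjc w)^-1.
have kb (v : R[i]) : 0 <= Im v -> `|k v| <= ((Im w)^-1)%:C.
  move=> v0; apply: ler_normV_Im => //.
  by rewrite ImB Im_conjc opprK ger0_norm ?addr_ge0 ?lerDr// ltW.
have E1 := boundary_poisson bT z0 a0.
have E2 := disc_alg_poisson Fz0 (disc_alg_cauchy_kernel Fz0 a0) kb.
have pE (v : R[i]) (g : R -> R) (v0 : 0 < Im v) :
    measurable_fun [set: R] g ->
    \int[leb]_t (poisson v t * poisson w (g t)) =
    - pi^-1 * \int[leb]_t (poisson v t * Im (k (g t)%:C)).
  move=> mg; rewrite -RintegralZl//.
    by apply: eq_Rintegral => t _; rewrite (poissonE _ w0) mulrCA.
  apply: (integrable_poissonM v0 (M := (Im w)^-1)).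
    have [] // := @cmeasurableV _ (measurableTypeR R) R (fun t => (g t)%:C - conjc w).
    by apply: cmeasurableB; [exact: cmeasurableC|exact: cmeasurable_cst].
  by move=> t; rewrite -lecR (le_trans (ler_normIm _))// kb.
have := pE z T z0 mT; rewrite /Rintegral => ->.
have := pE (F z) id Fz0 (@measurable_id _ _ _); rewrite /Rintegral => ->.
by congr (_ * _); rewrite -[LHS]/(\int[leb]_t (poisson z t * Im (k (T t)%:C))) E1 -E2.
Qed.

(** The bound on [g] holds only almost everywhere. It passes to the Cauchy law of [F z] by absolute
    continuity, and integrability of [g \o T] then follows from the equality of laws. *)
Lemma poisson_transport (g : R -> R) : g \in Lfun leb +oo%E ->
  \int[leb]_t (poisson z t * g (T t)) = \int[leb]_t (poisson (F z) t * g t).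
Proof.
move=> /Lfun_oo_bounded[mg [M gM]].
have mgE : measurable_fun [set: measurableTypeR R] (EFin \o g) by exact/measurable_EFinP.
have gP : {ae poisson_prob Fz0, forall t, `|g t| <= M}.
  case: gM => N [mN N0 sN]; exists N; split => //.
  by have /null_content_dominatesP := poisson_prob_dominates Fz0; apply.
have i2 := bounded_integrable_prob mg gP.
have eqP f : (\int[distribution (poisson_prob z0) T_mfun]_t f t =
    \int[poisson_prob Fz0]_t f t)%E.
  by apply: eq_measure_integral => A mA _; exact: distribution_boundary.
have i1 : (poisson_prob z0).-integrable [set: measurableTypeR R] (EFin \o (g \o T)).
  apply/integrableP; split.
    by apply/measurable_EFinP; exact: (measurableT_comp mg mT).
  case/integrableP : i2 => _; rewrite -eqP ge0_integral_pushforward//.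
  by apply: measurableT_comp.
rewrite -integral_poisson_probR// -[RHS]integral_poisson_probR//.
rewrite /Rintegral -[in RHS]eqP; congr fine.
rewrite [RHS]integral_pushforward//=; exact: i1.
Qed.

End transport.

(** * The Perron-Frobenius operator on Poisson kernels *)

Section perron_frobenius_poisson.
Context {R : realType}.
Variable mu : probability (measurableTypeR R) R.
Local Notation leb := (@lebesgue_measure R).
Local Notation F := (F_transform mu).
Variable T : R -> R.
Hypothesis bT : is_boundary_map mu T.
Implicit Type z : R[i].

Lemma poisson_Lfun1 z : 0 < Im z -> poisson z \in Lfun leb 1%E.
Proof. by move=> z0; apply/Lfun1_integrable; exact: integrable_poisson. Qed.

(** The input is only almost everywhere a Poisson kernel, so that the statement can be iterated:
    each image is itself a chosen representative. *)
Lemma perron_frobenius_poisson (f : R -> R) z : 0 < Im z ->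
  f \in Lfun leb 1%E -> {ae leb, forall t, f t = poisson z t} ->
  perron_frobenius T f \in Lfun leb 1%E /\
  {ae leb, forall t, perron_frobenius T f t = poisson (F z) t}.
Proof.
move=> z0 f1 fp; have Fz0 := Im_F_transform_gt0 mu z0.
have mT : measurable_fun [set: measurableTypeR R] (T : R -> measurableTypeR R).
  by case: bT.
have mf : measurable_fun [set: measurableTypeR R] f.
  by move/Lfun1_integrable : f1 => /measurable_int/measurable_EFinP.
have fE g : g \in Lfun leb +oo%E ->
    \int[leb]_t (f t * g (T t)) = \int[leb]_t (poisson (F z) t * g t).
  move=> goo; have [mg _] := Lfun_oo_bounded goo.
  have mgT : measurable_fun [set: measurableTypeR R] (g \o T).
    exact: (measurableT_comp mg mT).
  rewrite -(poisson_transport bT z0 goo) /Rintegral; congr fine.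
  apply: ae_eq_integral => //.
  - by apply/measurable_EFinP; exact: measurable_funM.
  - by apply/measurable_EFinP; apply: measurable_funM => //; exact: measurable_poisson.
  - case: fp => N [mN N0 sN]; exists N; split => //; apply: subset_trans sN => t /=.
    by apply: contra_not => -> _.
have [PL PE] : perron_frobenius T f \in Lfun leb 1%E /\
    forall g : R -> R, g \in Lfun leb +oo%E ->
      \int[leb]_x (perron_frobenius T f x * g x) = \int[leb]_x (f x * g (T x)).
  (* [xget] returns a genuine solution rather than its default value 0 because [poisson (F z)] is
     one. *)
  apply: (@xgetPex _ (cst 0) [set h : R -> R | h \in Lfun leb 1%E /\
    forall g : R -> R, g \in Lfun leb +oo%E ->
      \int[leb]_x (h x * g x) = \int[leb]_x (f x * g (T x))]).
  exists (poisson (F z)); split; first exact: poisson_Lfun1.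
  by move=> g goo; rewrite fE.
split => //; apply: Lfun1_ae_eq => //; first exact: poisson_Lfun1.
by move=> g goo; rewrite PE// fE.
Qed.

Lemma iter_perron_frobenius_poisson z k : 0 < Im z ->
  iter k (perron_frobenius T) (poisson z) \in Lfun leb 1%E /\
  {ae leb, forall t,
    iter k (perron_frobenius T) (poisson z) t = poisson (iter k F z) t}.
Proof.
move=> z0; elim: k => [|k [IH1 IH2]].
  by split; [exact: poisson_Lfun1|exact: aeW].
rewrite !iterS; apply: perron_frobenius_poisson => //.
elim: k {IH1 IH2} => [//|k IH]; rewrite iterS; exact: Im_F_transform_gt0.
Qed.

Lemma Im_iter_F_transform_ge z k : 0 < Im z -> Im z <= Im (iter k F z).
Proof.
move=> z0; elim: k => [//|k IH]; rewrite iterS (le_trans IH)//.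
by apply: Im_F_transform_ge; rewrite (lt_le_trans z0).
Qed.

End perron_frobenius_poisson.

(** * The orbit of a point under the F-transform *)

Section second_moment.
Context {R : realType}.
Variable mu : probability (measurableTypeR R) R.
Local Notation G := (cauchy_transform mu).
Local Notation F := (F_transform mu).
Hypothesis mu_mean : ('E_mu[fun t => t] = 0)%E.
Hypothesis mu_var : ('V_mu[fun t => t] = 1)%E.
Implicit Types (z : R[i]) (t : R).

Let integral_sqr : (\int[mu]_t (t ^+ 2)%:E = 1)%E.
Proof.
move: mu_var; rewrite /variance covariance.unlock mu_mean expectation.unlock /= => <-.
apply: eq_integral => t _.
by rewrite -[((_ \- _) * _)%R t]/((t - 0) * (t - 0)) !subr0 expr2.
Qed.

Let integrable_sqr : mu.-integrable [set: measurableTypeR R] (EFin \o (fun t : R => t ^+ 2)).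
Proof.
apply/integrableP; split.
  by apply/measurable_EFinP; apply: measurable_funX; exact: measurable_id.
under eq_integral do rewrite /= ger0_norm ?sqr_ge0//.
by rewrite integral_sqr ltry.
Qed.

Let Rintegral_sqr : \int[mu]_t (t ^+ 2) = 1.
Proof. by rewrite /Rintegral integral_sqr. Qed.

Let integrable_id : mu.-integrable [set: measurableTypeR R] (EFin \o (fun t : R => t)).
Proof.
have i1 : mu.-integrable [set: measurableTypeR R] (fun t : R => (1 + t ^+ 2)%:E).
  under eq_fun do rewrite EFinD.
  by apply: integrableD => //; exact: integrable_prob_cst.
apply: (le_integrable _ _ _ i1) => //.
  by apply/measurable_EFinP; exact: measurable_id.
move=> t _; rewrite /= lee_fin [leRHS]ger0_norm ?addr_ge0 ?sqr_ge0//.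
have := normr_ge0 t; have := sqr_ge0 (`|t| - 1); rewrite sqrrB real_normK ?num_real// expr1n; lra.
Qed.

Let Rintegral_id : \int[mu]_t (t : R) = 0.
Proof.
by move: mu_mean; rewrite expectation.unlock /Rintegral => ->.
Qed.

Let k z (t : measurableTypeR R) : R[i] := (t ^+ 2)%:C * (z - t%:C)^-1.
Let K z := cintegral mu (k z).

Let cmeasurable_k z : cmeasurable (k z).
Proof.
apply: cmeasurableM; last exact: cmeasurable_cauchy_kernel.
by apply: cmeasurableC; apply: measurable_funX; exact: measurable_id.
Qed.

Let norm_k z t : 0 < Im z -> `|k z t| <= (t ^+ 2 * (Im z)^-1)%:C.
Proof.
move=> z0; rewrite /k normrM normcR realcM (ger0_norm (sqr_ge0 t)).
by rewrite ler_wpM2l ?norm_cauchy_kernel_le// ler0c sqr_ge0.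
Qed.

Let integrable_sqrM (c : R) :
  mu.-integrable [set: measurableTypeR R] (EFin \o (fun t : R => t ^+ 2 * c)).
Proof. by rewrite /comp; under eq_fun do rewrite EFinM; exact: integrableZr. Qed.

Let cintegrable_k z : 0 < Im z -> cintegrable mu (k z).
Proof.
move=> z0; apply: (le_cintegrable (cmeasurable_k z) (integrable_sqrM (Im z)^-1)).
by move=> t; exact: norm_k.
Qed.

Let norm_K z : 0 < Im z -> `|K z| <= (2 * (Im z)^-1)%:C.
Proof.
move=> z0.
have := ler_norm_cintegral (cmeasurable_k z) (integrable_sqrM (Im z)^-1)
  (fun t => norm_k t z0).
by rewrite RintegralZr// Rintegral_sqr mul1r.
Qed.

(** Integrate [z ^+ 2 / (z - t) = z + t + t ^+ 2 / (z - t)]; the mean of [t] is 0. *)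
Let sqrM_cauchy_transform z : 0 < Im z -> z ^+ 2 * G z = z + K z.
Proof.
move=> z0.
have iz : cintegrable mu (fun=> z).
  by apply: (@cintegrable_bounded _ _ _ (`|Re z| + `|Im z|)) => [|t];
    [exact: cmeasurable_cst|exact: ler_normc_add].
have it : cintegrable mu (fun t : measurableTypeR R => t%:C).
  apply: (@le_cintegrable _ _ _ _ _ (fun t : measurableTypeR R => `|t : R|)).
  - exact: cmeasurable_real.
  - exact: (integrable_norm integrable_id).
  - by move=> t; rewrite normcR.
have Ez : cintegral mu (fun=> z) = z.
  by apply: complexP; rewrite /= Rintegral_prob_cst.
have Et : cintegral mu (fun t : measurableTypeR R => t%:C) = 0.
  by apply: complexP; rewrite /= ?Rintegral_id// /Rintegral integral0.
have ik := cintegrable_k z0; have ic := cintegrable_cauchy_kernel mu z0.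
transitivity (cintegral mu (fun t => (z + t%:C) + k z t)); last first.
  rewrite cintegralD//; last exact: cintegrableD.
  by rewrite cintegralD// Ez Et addr0.
rewrite /cauchy_transform -cintegralZl//.
congr cintegral; apply/funext => t; rewrite /k.
have n1 : z - t%:C != 0 by apply: Im_neq0; rewrite ImB /= subr0 gt_eqF.
rewrite [(t ^+ 2)%:C](_ : _ = t%:C ^+ 2); last by rewrite rmorphXn.
by field; rewrite n1.
Qed.

(** Majorant for [z * K z - 1], the integral of [t ^+ 2 * (z / (z - t) - 1)]. The last factor equals
    [t / (z - t)], at most [|t| / Y]; in the cone it is also at most 3, as [|z / (z - t)| <= 2]. The
    cap keeps the integrand below [3 * t ^+ 2], so a finite second moment is enough for dominated
    convergence. *)
Let tail (Y : R) := \int[mu]_t (t ^+ 2 * Num.min 3 (`|t| / Y)).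

Let measurable_tail_fun (Y : R) : measurable_fun [set: measurableTypeR R]
  (fun t : R => t ^+ 2 * Num.min 3 (`|t| / Y)).
Proof.
apply: measurable_funM; first by apply: measurable_funX; exact: measurable_id.
apply: measurable_minr; first exact: measurable_cst.
apply: measurable_funM; last exact: measurable_cst.
exact: normr_measurable.
Qed.

Let min_ge0 (Y t : R) : 0 < Y -> 0 <= Num.min 3 (`|t| / Y).
Proof. by move=> Y0; rewrite le_min ler0n divr_ge0 ?normr_ge0// (ltW Y0). Qed.

Let cvg_tail : tail n.+1%:R @[n --> \oo] --> (0 : R).
Proof.
rewrite [X in _ --> X](_ : _ = \int[mu]_t cst 0 t); last first.
  by rewrite /Rintegral integral0.
apply: (@Rintegral_dominated_cvg _ (measurableTypeR R) R mu _ _ (fun t => t ^+ 2 * 3)) => //.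
- apply: aeW => t; rewrite /cst -[X in _ --> X](mulr0 (t ^+ 2)).
  apply: cvgM; first exact: cvg_cst.
  apply: (@cvg_dist_bound _ _ (fun n => `|t| * n.+1%:R^-1)).
    apply: nearW => n; rewrite sub0r normrN (ger0_norm (min_ge0 _ _))//.
    by rewrite ge_min lexx orbT.
  have -> : (0 : R) = `|t : R| * 0 by rewrite mulr0.
  by apply: cvgM; [exact: cvg_cst|exact: cvg_harmonic].
- move=> n t; have m0 : 0 <= Num.min 3 (`|t : R| / n.+1%:R) by exact: min_ge0.
  rewrite (ger0_norm (mulr_ge0 (sqr_ge0 t) m0)).
  by rewrite ler_wpM2l ?sqr_ge0// ge_min lexx.
Qed.

Let integrable_tail (Y : R) : 0 < Y -> mu.-integrable [set: measurableTypeR R]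
  (EFin \o (fun t : R => t ^+ 2 * Num.min 3 (`|t| / Y))).
Proof.
move=> Y0; apply: (le_integrable _ _ _ (integrable_sqrM 3)) => //.
  by apply/measurable_EFinP; exact: measurable_tail_fun.
move=> t _; have m0 : 0 <= Num.min 3 (`|t : R| / Y) by exact: min_ge0.
rewrite /= lee_fin (ger0_norm (mulr_ge0 (sqr_ge0 t) m0)) [leRHS]ger0_norm.
  by rewrite ler_wpM2l ?sqr_ge0// ge_min lexx.
by rewrite (mulr_ge0 (sqr_ge0 t)).
Qed.

(** Above the axis, [Re (z ^+ 2) <= 0] encodes the cone [|Re z| <= Im z]; this form suits an
    induction on squares. *)
Let norm_le_2Im z : 0 < Im z -> Re (z ^+ 2) <= 0 -> `|z| <= (2 * Im z)%:C.
Proof.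
rewrite expr2 ReM => z0 zc; rewrite (le_trans (ler_normc_add _))// lecR.
have : `|Re z| <= Im z.
  by rewrite ler_norml; apply/andP; split; nra.
by rewrite (ger0_norm (ltW z0)); lra.
Qed.

Let norm_zK z (Y : R) : 0 < Y -> Y <= Im z -> Re (z ^+ 2) <= 0 ->
  `|z * K z - 1| <= (2 * tail Y)%:C.
Proof.
move=> Y0 Yz zc; have z0 : 0 < Im z by rewrite (lt_le_trans Y0).
have ik := cintegrable_k z0.
have ms : cmeasurable (fun t : measurableTypeR R => (t ^+ 2)%:C).
  by apply: cmeasurableC; apply: measurable_funX; exact: measurable_id.
have is2 : cintegrable mu (fun t : measurableTypeR R => (t ^+ 2)%:C).
  apply: (le_cintegrable ms integrable_sqr) => t.
  by rewrite normcR ger0_norm ?sqr_ge0.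
have <- : cintegral mu (fun t : measurableTypeR R => (t ^+ 2)%:C) = 1.
  by apply: complexP; rewrite /= ?Rintegral_sqr// /Rintegral integral0.
rewrite -cintegralZl// -cintegralB//; last exact: cintegrableZl.
have mh : cmeasurable (fun t : measurableTypeR R => z * k z t - (t ^+ 2)%:C).
  by apply: cmeasurableB => //; apply: cmeasurableM => //; exact: cmeasurable_cst.
apply: (ler_norm_cintegral mh (integrable_tail Y0)).
move=> t; have n1 : z - t%:C != 0 by apply: Im_neq0; rewrite ImB /= subr0 gt_eqF.
have -> : z * k z t - (t ^+ 2)%:C = (t ^+ 2)%:C * (z * (z - t%:C)^-1 - 1).
  by rewrite /k; ring.
rewrite normrM normcR (ger0_norm (sqr_ge0 t)) realcM ler_wpM2l ?ler0c ?sqr_ge0//.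
have kz := norm_cauchy_kernel_le t z0.
have h1 : `|z * (z - t%:C)^-1 - 1| <= 3%:C.
  rewrite (le_trans (ler_normB _ _))// normr1 normrM.
  rewrite (@le_trans _ _ ((2 * Im z)%:C * (Im z)^-1%:C + 1))//.
    by rewrite lerD2r ler_pM// norm_le_2Im.
  by rewrite -realcM mulfK ?gt_eqF// -[(1 : R[i])]/(1%:C) -realcD lecR; lra.
have h2 : `|z * (z - t%:C)^-1 - 1| <= (`|t| / Y)%:C.
  have -> : z * (z - t%:C)^-1 - 1 = t%:C * (z - t%:C)^-1 by field; rewrite n1.
  rewrite normrM normcR realcM ler_wpM2l ?ler0c// (le_trans kz)// lecR.
  by rewrite lef_pV2 ?posrE.
by case: (leP 3 (`|t| / Y)).
Qed.

(** Put [c = K z / z] and [d = z * K z - 1], both small. Then [F z = z / (1 + c)] and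
    [z ^+ 2 * c = 1 + d]; the leading term [- 2 * z ^+ 2 * c] of the expansion of
    [F z ^+ 2 - z ^+ 2] yields the -2. *)
Lemma F_transform_sqr (e : R) : 0 < e -> exists2 Y : R, 0 < Y &
  forall z, Y <= Im z -> Re (z ^+ 2) <= 0 ->
    `|(F z) ^+ 2 - z ^+ 2 + 2| <= e%:C.
Proof.
(* If [|c|] and [|d|] are at most [r <= 1/2], the numerator found below is at most
   [5 r + 3 r^2 <= 13 r / 2] and the denominator at least 1/4, whence 26. *)
move=> e0; pose r := Num.min 2^-1 (e / 26).
have r0 : 0 < r by rewrite lt_min invr_gt0 ltr0n divr_gt0.
have r2 : r <= 2^-1 by rewrite ge_min lexx.
have r26 : 26 * r <= e by rewrite -ler_pdivlMl// mulrC ge_min lexx orbT.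
have [n nr] : exists n : nat, 2 * tail n.+1%:R <= r /\ 2 / n.+1%:R <= r :> R.
  have h : \forall n \near \oo, `|0 - tail n.+1%:R| <= r / 2.
    by move/cvgrPdist_le : cvg_tail; apply; rewrite divr_gt0.
  have h' : \forall n \near \oo, `|0 - n.+1%:R^-1 : R| <= r / 2.
    have /cvgrPdist_le := @cvg_harmonic R; apply; exact: divr_gt0.
  near \oo => n; exists n; split.
    rewrite mulrC -ler_pdivlMr// (le_trans (ler_norm _))// -normrN -sub0r.
    by near: n.
  rewrite mulrC -ler_pdivlMr// (le_trans (ler_norm _))// -normrN -sub0r.
  by near: n.
exists n.+1%:R => // z nz zc.
have Y0 : 0 < n.+1%:R :> R by rewrite ltr0n.
have z0 : 0 < Im z by rewrite (lt_le_trans Y0).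
have zn0 : z != 0 by apply: Im_neq0; rewrite gt_eqF.
pose d := z * K z - 1; pose c := K z / z.
have dr : `|d| <= r%:C by rewrite (le_trans (norm_zK Y0 nz zc))// lecR; case: nr.
have cr : `|c| <= r%:C.
  rewrite normrM (@le_trans _ _ ((2 * (Im z)^-1)%:C * 1))//.
    rewrite ler_pM ?norm_K// (@le_trans _ _ (Im z)^-1%:C)//.
      by apply: ler_normV_Im => //; exact: ler_norm.
    rewrite -[(1 : R[i])]/(1%:C) lecR invf_le1// (le_trans _ nz)//.
    by rewrite ler1n.
  rewrite mulr1 lecR; case: nr => _; apply: le_trans.
  by rewrite ler_wpM2l// lef_pV2 ?posrE.
have c1 : 2^-1%:C <= `|1 + c|.
  rewrite -[c]opprK (le_trans _ (lerB_dist _ _))// normr1 normrN lerBrDr.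
  have -> : 1 = 2^-1%:C + 2^-1%:C :> R[i].
    by rewrite -realcD -[LHS]/(1%:C); congr (_%:C); lra.
  by rewrite lerD2l (le_trans cr)// lecR.
have c1' : 1 + c != 0.
  by rewrite -normr_gt0 (lt_le_trans _ c1)// ltcR.
have KE : K z = c * z by rewrite /c divfK.
have dE : z ^+ 2 * c = 1 + d by rewrite /d addrC subrK KE; ring.
have FE : F z = z / (1 + c).
  rewrite F_transformE -[z / _]invrK invf_div; congr (_^-1).
  apply: (mulfI (expf_neq0 2 zn0)); rewrite sqrM_cauchy_transform// KE.
  by field.
have FE2 : (F z) ^+ 2 - z ^+ 2 + 2 =
    (3 * c + 2 * c ^+ 2 - 2 * d - d * c) / (1 + c) ^+ 2.
  have -> : d = z ^+ 2 * c - 1 by rewrite dE addrC addKr.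
  by rewrite FE; move: c1'; move: (c) => u u1; field.
have rr : r * r <= 2^-1 * r by rewrite ler_wpM2r// ltW.
rewrite FE2 normf_div ler_pdivrMr ?normr_gt0 ?expf_neq0//.
apply: (@le_trans _ _ (3 * r + 2 * (r * r) + 2 * r + r * r)%:C).
  have nM (x y : R[i]) (u v : R) : `|x| <= u%:C -> `|y| <= v%:C -> `|x * y| <= (u * v)%:C.
    by move=> xu yv; rewrite normrM realcM ler_pM.
  have n2 : `|2 : R[i]| <= 2%:C by rewrite normr_nat -[leRHS]/(2%:R%:C) rmorph_nat.
  have n3 : `|3 : R[i]| <= 3%:C by rewrite normr_nat -[leRHS]/(3%:R%:C) rmorph_nat.
  rewrite (le_trans (ler_normB _ _))// realcD lerD ?nM//.
  rewrite (le_trans (ler_normB _ _))// realcD lerD ?nM//.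
  by rewrite (le_trans (ler_normD _ _))// realcD lerD ?nM//.
apply: (@le_trans _ _ (e%:C * (2^-1 ^+ 2)%:C)).
  by rewrite -realcM lecR; lra.
rewrite ler_wpM2l ?ler0c ?(ltW e0)// normrX expr2 realcM expr2.
by rewrite ler_pM// ler0c invr_ge0.
Unshelve. all: by end_near. Qed.

End second_moment.

(** * Stolz-Cesaro averaging and square roots of limits *)

Section real_sequences.
Context {R : realType}.
Implicit Types (u v c x y : R^nat) (l t : R).

(** Past a rank [N], each increment of [D] is at most [e / 2] times that of [v]; these bounds add
    up, and the fixed contribution of [N] is absorbed as [v] grows. *)
Lemma stolz_cesaro v c l : (forall k, v k < v k.+1) ->
  v n @[n --> \oo] --> +oo ->
  c k / (v k.+1 - v k) @[k --> \oo] --> l ->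
  (\sum_(0 <= k < n) c k) / v n @[n --> \oo] --> l.
Proof.
move=> vS voo cl; apply/cvgrPdist_le => e e0.
have e20 : 0 < e / 2 by rewrite divr_gt0.
pose D n := \sum_(0 <= k < n) c k - l * v n.
have [N _ hN] : \forall k \near \oo, `|l - c k / (v k.+1 - v k)| <= e / 2.
  by move/cvgrPdist_le : cl; apply.
have DN n : `|D (N + n)%N - D N| <= e / 2 * (v (N + n)%N - v N).
  elim: n => [|n IH]; first by rewrite addn0 !subrr mulr0 normr0.
  rewrite addnS /D big_nat_recr//= -/(D N).
  set m := (N + n)%N; have w0 : 0 < v m.+1 - v m by rewrite subr_gt0.
  have -> : \sum_(0 <= k < m) c k + c m - l * v m.+1 - D N =
      (D m - D N) - (l - c m / (v m.+1 - v m)) * (v m.+1 - v m).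
    by rewrite mulrBl divfK ?gt_eqF// /D; ring.
  rewrite (le_trans (ler_normB _ _))// (le_trans (lerD IH (lexx _)))// normrM.
  rewrite (gtr0_norm w0) (_ : v m.+1 - v N = (v m - v N) + (v m.+1 - v m)); last ring.
  by rewrite [leRHS]mulrDr lerD2l (ler_wpM2r (ltW w0))// hN//= leq_addr.
(* The entry 1 makes [v n] positive; the other one gives [|D N| + e / 2 * |v N| <= e / 2 * v n],
   with [|v N|] because [v N] may be negative. *)
pose M := Num.max 1 (2 / e * (`|D N| + e / 2 * `|v N|)).
near=> n.
have Nn : (N <= n)%N by near: n; exact: nbhs_infty_ge.
have : M <= v n by near: n; move/cvgryPge : voo; apply.
rewrite ge_max => /andP[v1 vM].
have v0 : 0 < v n by rewrite (lt_le_trans _ v1).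
have -> : l - (\sum_(0 <= k < n) c k) / v n = - (D n / v n).
  by rewrite /D mulrBl mulfK ?gt_eqF// opprB.
rewrite normrN normrM normfV (gtr0_norm v0) ler_pdivrMr//.
have := DN (n - N)%N; rewrite subnKC// => h.
have h2 : `|D n| <= `|D n - D N| + `|D N| by rewrite -{1}(subrK (D N) (D n)) ler_normD.
have h3 : `|D N| + e / 2 * `|v N| <= e / 2 * v n.
  rewrite -ler_pdivrMl// (_ : (e / 2)^-1 = 2 / e)//.
  by rewrite invf_div.
have h4 : - (e / 2 * v N) <= e / 2 * `|v N|.
  by rewrite -mulrN ler_wpM2l ?(ltW e20)// -normrN ler_norm.
rewrite mulrBr in h; lra.
Unshelve. all: by end_near. Qed.

Lemma cvgr_sqrtn : Num.sqrt (n%:R : R) @[n --> \oo] --> +oo.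
Proof.
apply/cvgryPge => A; near=> n.
have An : A ^+ 2 <= n%:R by near: n; exact: nbhs_infty_ger.
by rewrite (le_trans (ler_norm A))// -sqrtr_sqr ler_wsqrtr.
Unshelve. all: by end_near. Qed.

Lemma cvg_sqrtnV : (Num.sqrt (n%:R : R))^-1 @[n --> \oo] --> (0 : R).
Proof.
apply/gtr0_cvgV0; last exact: cvgr_sqrtn.
by near=> n; rewrite sqrtr_gt0 ltr0n; near: n; exact: nbhs_infty_gt.
Unshelve. all: by end_near. Qed.

(** Stolz-Cesaro with denominators [sqrt n]: the inverse of [sqrt (k + 1) - sqrt k] is
    [sqrt k * (1 + sqrt (1 + 1 / k))], whence the factor 2. *)
Lemma cvg_sum_sqrtn c l : Num.sqrt k%:R * c k @[k --> \oo] --> l ->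
  (\sum_(0 <= k < n) c k) / Num.sqrt n%:R @[n --> \oo] --> 2 * l.
Proof.
move=> cl; apply: stolz_cesaro.
- by move=> k; rewrite ltr_sqrt ?ltr0n// ltr_nat.
- exact: cvgr_sqrtn.
have h : Num.sqrt (1 + k%:R^-1 : R) @[k --> \oo] --> (1 : R).
  rewrite [X in _ --> X](_ : 1 = Num.sqrt (1 + 0)); last by rewrite addr0 sqrtr1.
  apply: continuous_cvg; first exact: sqrt_continuous.
  apply: cvgD; first exact: cvg_cst.
  apply/gtr0_cvgV0; last exact: cvgr_idn.
  by near=> n; rewrite ltr0n; near: n; exact: nbhs_infty_gt.
have : Num.sqrt k%:R * c k * (1 + Num.sqrt (1 + k%:R^-1)) @[k --> \oo] --> 2 * l.
  have -> : 2 * l = l * (1 + 1) by ring.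
  by apply: cvgM => //; apply: cvgD => //; exact: cvg_cst.
apply: cvg_trans; apply: near_eq_cvg; near=> k.
have k0 : 0 < k%:R :> R by rewrite ltr0n; near: k; exact: nbhs_infty_gt.
have s0 : 0 < Num.sqrt k%:R :> R by rewrite sqrtr_gt0.
have -> : Num.sqrt k.+1%:R = Num.sqrt k%:R * Num.sqrt (1 + k%:R^-1) :> R.
  by rewrite -sqrtrM// mulrDr mulr1 mulfV ?gt_eqF// -natr1.
have : Num.sqrt k%:R ^+ 2 = k%:R :> R by rewrite sqr_sqrtr.
have : Num.sqrt (1 + k%:R^-1) ^+ 2 = 1 + k%:R^-1 :> R by rewrite sqr_sqrtr// addr_ge0.
have : 0 <= Num.sqrt (1 + k%:R^-1) :> R by exact: sqrtr_ge0.
move: s0; move: (Num.sqrt k%:R) (Num.sqrt (1 + k%:R^-1)) => r s r0 s0 sE rE.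
have rs0 : 0 < r * (1 + s) by rewrite mulr_gt0// ltr_wpDr.
have -> : r * s - r = (r * (1 + s))^-1.
  apply: (mulIf (lt0r_neq0 rs0)); rewrite mulVf ?gt_eqF//.
  have -> : (r * s - r) * (r * (1 + s)) = r ^+ 2 * (s ^+ 2 - 1) by ring.
  by rewrite rE sE addrAC subrr add0r mulfV ?gt_eqF.
by rewrite invrK; ring.
Unshelve. all: by end_near. Qed.

(** A complex number is recovered from its square: [(u^2 + v^2)^2 = (u^2 - v^2)^2 + 4 (u v)^2] gives
    the limit of [u^2 + v^2], hence those of [u^2] and [v^2]; the sign of [v] selects the root. *)
Lemma cvg_sqr_split u v : (forall k, 0 <= v k) ->
  u k ^+ 2 - v k ^+ 2 @[k --> \oo] --> - (2 : R) ->
  u k * v k @[k --> \oo] --> (0 : R) ->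
  u k @[k --> \oo] --> (0 : R) /\ v k @[k --> \oo] --> Num.sqrt (2 : R).
Proof.
move=> v0 h1 h2.
have hs : u k ^+ 2 + v k ^+ 2 @[k --> \oo] --> (2 : R).
  have -> : (fun k => u k ^+ 2 + v k ^+ 2) =
      (fun k => Num.sqrt ((u k ^+ 2 - v k ^+ 2) ^+ 2 + 4 * (u k * v k) ^+ 2)).
    apply/funext => k; rewrite (_ : _ + 4 * _ = (u k ^+ 2 + v k ^+ 2) ^+ 2); last ring.
    by rewrite sqrtr_sqr ger0_norm// addr_ge0 ?sqr_ge0.
  rewrite [X in _ --> X](_ : _ = Num.sqrt ((- 2) ^+ 2 + 4 * 0 ^+ 2)); last first.
    by rewrite expr0n mulr0 addr0 sqrtr_sqr normrN ger0_norm.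
  apply: continuous_cvg; first exact: sqrt_continuous.
  have cvg_sqr (f : R^nat) l : f k @[k --> \oo] --> l -> f k ^+ 2 @[k --> \oo] --> l ^+ 2.
    by move=> fl; rewrite expr2; under eq_fun do rewrite expr2; exact: cvgM.
  by apply: cvgD; [exact: cvg_sqr|apply: cvgM; [exact: cvg_cst|exact: cvg_sqr]].
split.
  apply/norm_cvg0P.
  have -> : (fun k => `|u k|) = (fun k => Num.sqrt
      (2^-1 * ((u k ^+ 2 + v k ^+ 2) + (u k ^+ 2 - v k ^+ 2)))).
    by apply/funext => k; rewrite -sqrtr_sqr; congr Num.sqrt; field.
  rewrite [X in _ --> X](_ : _ = Num.sqrt (2^-1 * (2 + - 2))); last first.
    by rewrite subrr mulr0 sqrtr0.
  apply: continuous_cvg; first exact: sqrt_continuous.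
  by apply: cvgM; [exact: cvg_cst|exact: cvgD].
have -> : v = (fun k => Num.sqrt
    (2^-1 * ((u k ^+ 2 + v k ^+ 2) - (u k ^+ 2 - v k ^+ 2)))).
  apply/funext => k; rewrite (_ : _ * _ = v k ^+ 2); last by field.
  by rewrite sqrtr_sqr ger0_norm.
rewrite [X in _ --> X](_ : _ = Num.sqrt (2^-1 * (2 - - 2))); last first.
  by congr Num.sqrt; lra.
apply: continuous_cvg; first exact: sqrt_continuous.
by apply: cvgM; [exact: cvg_cst|exact: cvgB].
Qed.

End real_sequences.

(** * Asymptotics of the orbit and of the sum of its Poisson kernels *)

Section orbit.
Context {R : realType}.
Variable mu : probability (measurableTypeR R) R.
Local Notation F := (F_transform mu).
Hypothesis mu_mean : ('E_mu[fun t => t] = 0)%E.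
Hypothesis mu_var : ('V_mu[fun t => t] = 1)%E.

Let ler_normc_ReIm (w : R[i]) (e : R) : `|w| <= e%:C -> `|Re w| <= e /\ `|Im w| <= e.
Proof.
by move=> we; rewrite -!lecR; split; apply: le_trans we; [exact: ler_normRe|exact: ler_normIm].
Qed.

(** With error at most 1 above height [Y], each step lowers [Re (z ^+ 2)] by at least 1. This keeps
    the orbit in the cone and drives it upwards, so the error tends to 0 and averaging the
    increments gives the slope -2. *)
Lemma iter_F_transform_sqr_cvg : exists2 z0, 0 < Im z0 &
  Re (iter k F z0 ^+ 2) / k%:R @[k --> \oo] --> - (2 : R) /\
  Im (iter k F z0 ^+ 2) / k%:R @[k --> \oo] --> (0 : R).
Proof.
have [Y Y0 FY] := F_transform_sqr mu_mean mu_var ltr01.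
pose z0 : R[i] := 0 +i* Y; exists z0 => //.
pose z k := iter k F z0.
have zY k : Y <= Im (z k) by exact: (@Im_iter_F_transform_ge _ mu z0).
have zre k : Re (z k ^+ 2) <= - k%:R.
  elim: k => [|k IH]; first by rewrite expr2 ReM/= mul0r sub0r lerN2 mulr_ge0// ltW.
  have zc : Re (z k ^+ 2) <= 0 by rewrite (le_trans IH)// oppr_le0.
  have [h _] := ler_normc_ReIm (FY _ (zY k) zc).
  rewrite -natr1 -[z k.+1]/(F (z k)); move: h; rewrite ReD ReB/= ler_norml => /andP[_].
  lra.
have zcone k : Re (z k ^+ 2) <= 0 by rewrite (le_trans (zre k))// oppr_le0.
have step e : 0 < e -> \forall k \near \oo, `|(z k.+1) ^+ 2 - (z k) ^+ 2 + 2| <= e%:C.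
  move=> e0; have [Y' Y'0 FY'] := F_transform_sqr mu_mean mu_var e0.
  near=> k; apply: FY' => //.
  (* [Re (z k ^+ 2) <= - k] forces [k <= Im (z k) ^+ 2], so the orbit eventually stays above any
     height [Y']. *)
  have : Y' ^+ 2 <= k%:R by near: k; exact: nbhs_infty_ger.
  have := zre k; rewrite expr2 ReM expr2 => h1 h2.
  rewrite leNgt; apply/negP => h3; have := lt_le_trans Y0 (zY k); nra.
have n_oo := @cvgr_idn R.
(* Used for the real and the imaginary part: telescoping and Stolz-Cesaro with denominators [n]; the
   initial term disappears on division. *)
have lim (f : R[i] -> R) (l : R) : (forall u v, f (u - v) = f u - f v) ->
    f (z k.+1 ^+ 2 - z k ^+ 2) @[k --> \oo] --> l ->
    f (z k ^+ 2) / k%:R @[k --> \oo] --> l.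
  move=> fB fl.
  have h : (\sum_(0 <= k < n) (f (z k.+1 ^+ 2) - f (z k ^+ 2))) / n%:R @[n --> \oo] --> l.
    apply: (@stolz_cesaro _ (fun n => n%:R)) => //.
      by move=> k; rewrite ltr_nat.
    by under eq_fun do rewrite -natr1 addrAC subrr add0r divr1 -fB.
  have -> : (fun k : nat => f (z k ^+ 2) / k%:R) = (fun n =>
      (\sum_(0 <= k < n) (f (z k.+1 ^+ 2) - f (z k ^+ 2))) / n%:R +
      f (z0 ^+ 2) * n%:R^-1).
    apply/funext => n; rewrite (telescope_sumr (fun k => f (z k ^+ 2)))//.
    by rewrite -mulrDl subrK.
  rewrite -[l]addr0; apply: cvgD => //.
  have -> : (0 : R) = f (z0 ^+ 2) * 0 by rewrite mulr0.
  apply: cvgM; first exact: cvg_cst.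
  apply/gtr0_cvgV0 => //.
  by near=> k; rewrite ltr0n; near: k; exact: nbhs_infty_gt.
split; apply: lim; [exact: ReB| |exact: ImB|].
- apply/cvgrPdist_le => e e0; near=> k.
  have /ler_normc_ReIm[h _] : `|(z k.+1) ^+ 2 - (z k) ^+ 2 + 2| <= e%:C.
    by near: k; exact: step.
  by move: h; rewrite ReD/= -normrN; congr (`|_| <= _); lra.
- apply/cvgrPdist_le => e e0; near=> k.
  have /ler_normc_ReIm[_ h] : `|(z k.+1) ^+ 2 - (z k) ^+ 2 + 2| <= e%:C.
    by near: k; exact: step.
  by move: h; rewrite ImD/= -normrN; congr (`|_| <= _); lra.
Unshelve. all: by end_near. Qed.

(** Divided by [sqrt k], the orbit tends to [i sqrt 2], so [sqrt k] times the kernel at [t] tends to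
    [sqrt 2 / (2 pi)] whatever [t] is; summation doubles this constant. *)
Lemma sum_poisson_cvg : exists2 z0, 0 < Im z0 & forall t : R,
  (\sum_(0 <= k < n) poisson (iter k F z0) t) / (Num.sqrt (2 * n%:R) / pi)
    @[n --> \oo] --> (1 : R).
Proof.
have [z0 z00 [hre him]] := iter_F_transform_sqr_cvg.
exists z0 => // t.
pose x k := Re (iter k F z0) / Num.sqrt k%:R.
pose y k := Im (iter k F z0) / Num.sqrt k%:R.
have y0 k : 0 < Im (iter k F z0) by rewrite (lt_le_trans z00)// Im_iter_F_transform_ge.
have s2 k : Num.sqrt k%:R ^+ 2 = k%:R :> R by rewrite sqr_sqrtr.
have [xl yl] : x k @[k --> \oo] --> (0 : R) /\ y k @[k --> \oo] --> Num.sqrt (2 : R).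
  apply: cvg_sqr_split.
  - by move=> k; rewrite /y divr_ge0 ?sqrtr_ge0// ltW.
  - apply: cvg_trans hre; apply: near_eq_cvg; apply: nearW => k.
    rewrite /x /y [(_ / _) ^+ _]exprMn [(Im _ / _) ^+ _]exprMn exprVn s2 -mulrBl.
    by rewrite expr2 ReM -!expr2.
  - have -> : (0 : R) = 2^-1 * 0 by rewrite mulr0.
    have -> : (fun k => x k * y k) = (fun k => 2^-1 * (Im (iter k F z0 ^+ 2) / k%:R)).
      apply/funext => k; rewrite -(s2 k) /x /y expr2 ImM expr2 invfM.
      move: (Re _) (Im _) (_^-1) => a b c; by field.
    by apply: cvgM => //; exact: cvg_cst.
have sp : Num.sqrt k%:R * poisson (iter k F z0) t @[k --> \oo] --> pi^-1 * (Num.sqrt 2 / 2).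
  have h : pi^-1 * (y k / ((t * (Num.sqrt k%:R)^-1 - x k) ^+ 2 + y k ^+ 2))
      @[k --> \oo] --> pi^-1 * (Num.sqrt 2 / 2).
    apply: cvgM; first exact: cvg_cst.
    apply: cvgM => //; apply: cvgV => //.
    rewrite [X in _ --> X](_ : _ = (t * 0 - 0) * (t * 0 - 0) + Num.sqrt 2 * Num.sqrt 2); last first.
      by rewrite mulr0 subr0 mulr0 add0r -expr2 sqr_sqrtr.
    under eq_fun do rewrite !expr2.
    have tx : t * (Num.sqrt k%:R)^-1 - x k @[k --> \oo] --> t * 0 - 0.
      by apply: cvgB => //; apply: cvgM; [exact: cvg_cst|exact: cvg_sqrtnV].
    by apply: cvgD; exact: cvgM.
  apply: cvg_trans h; apply: near_eq_cvg; near=> k.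
  have s0 : Num.sqrt k%:R != 0 :> R.
    by rewrite sqrtr_eq0 -ltNge ltr0n; near: k; exact: nbhs_infty_gt.
  rewrite /poisson invfM [Im _ * (_ * _)]mulrCA [RHS]mulrCA; congr (_ * _).
  have := y0 k; rewrite /x /y; move: (Re _) (Im _) (Num.sqrt _) s0 => a b s s0 b0.
  have d0 : (t - a) ^+ 2 + b ^+ 2 != 0.
    by rewrite gt_eqF// ltr_wpDl ?sqr_ge0// exprn_gt0.
  have -> : (t / s - a / s) ^+ 2 + (b / s) ^+ 2 = ((t - a) ^+ 2 + b ^+ 2) / (s * s).
    by field; rewrite s0.
  by move: (_ + _) d0 => D d0; field; rewrite s0 d0.
have := cvg_sum_sqrtn sp.
set S := fun n => \sum_(0 <= k < n) poisson (iter k F z0) t => Sl.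
have s20 : Num.sqrt 2 != 0 :> R by rewrite sqrtr_eq0 -ltNge.
have -> : (fun n => S n / (Num.sqrt (2 * n%:R) / pi)) =
    (fun n => (S n / Num.sqrt n%:R) * (pi / Num.sqrt 2)).
  apply/funext => n; rewrite sqrtrM// invf_div invfM; ring.
rewrite [X in _ --> X](_ : 1 =
    2 * (pi^-1 * (Num.sqrt 2 / 2)) * (pi / Num.sqrt 2)); last first.
  have := lt0r_neq0 (pi_gt0 R); move: (pi : R) (Num.sqrt _) s20 => p s s0 p0.
  by field; rewrite s0 p0.
by apply: cvgM => //; exact: cvg_cst.
Unshelve. all: by end_near. Qed.

End orbit.

Theorem theorem1p2 (R : realType) (mu : probability (measurableTypeR R) R)
  (mu_singular : mutually_singular mu (@lebesgue_measure R))
  (mu_mean : ('E_mu[fun t => t] = 0)%E)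
  (mu_var : ('V_mu[fun t => t] = 1)%E)
  (T : R -> R) (T_boundary : is_boundary_map mu T)
  (a : R^nat) (a_return : is_return_sequence T a) :
  seq_equivalent a (fun n : nat => Num.sqrt (2 * n%:R) / pi).
Proof.
have [z0 z00 hS] := sum_poisson_cvg mu_mean mu_var.
have [a0 aS] := a_return.
have hA := aS _ (poisson_Lfun1 z00).
have hP k := (iter_perron_frobenius_poisson T_boundary k z00).2.
have {}hP : {ae @lebesgue_measure R, forall t, forall k,
    iter k (perron_frobenius T) (poisson z0) t = poisson (iter k (F_transform mu) z0) t}.
  exact/ae_foralln.
(* A single point [t] outside the null set suffices, because neither [a] nor the claimed equivalent
   depends on it. *)
have [N [mN N0 sN]] :=
  @filterI _ _ (ae_filter_ringOfSetsType (@lebesgue_measure R)) _ _ hA hP.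
have [t Nt] : exists t, ~ N t.
  apply/existsNP => NT; have := @lebesgue_measure_setT_gt0 R.
  by rewrite (_ : setT = N) ?N0 ?ltxx//; apply/seteqP; split.
have [tA tP] : _ /\ _ := contra_notP (@sN t) Nt.
pose S n := \sum_(0 <= k < n) poisson (iter k (F_transform mu) z0) t.
have {}tA : (a n)^-1 * S n @[n --> \oo] --> (1 : R).
  have -> : (1 : R) = \int[@lebesgue_measure R]_t poisson z0 t.
    by rewrite /Rintegral integral_poisson.
  by move: tA; under eq_fun do under eq_bigr do rewrite tP.
have S0 n : (0 < n)%N -> 0 < S n.
  move=> n0; rewrite /S big_ltn// ltr_wpDr ?poisson_gt0//.
  by rewrite sumr_ge0// => k _; rewrite poisson_ge0// (lt_le_trans z00)// Im_iter_F_transform_ge.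
rewrite /seq_equivalent [X in _ --> X](_ : 1 = 1 * 1^-1); last by rewrite invr1 mulr1.
(* The ratio sought is the quotient of [S n] over the claimed equivalent by [S n] over [a n], and
   both tend to 1. *)
have : S n / (Num.sqrt (2 * n%:R) / pi) * ((a n)^-1 * S n)^-1 @[n --> \oo] --> (1 * 1^-1 : R).
  by apply: cvgM; [exact: hS|apply: cvgV => //; exact: oner_neq0].
apply: cvg_trans; apply: near_eq_cvg; near=> n.
have Sn0 : S n != 0 by rewrite gt_eqF// S0//; near: n; exact: nbhs_infty_gt.
move: (Num.sqrt _ / pi) => b.
by rewrite [(_^-1 * _)^-1]invfM invrK [S n / b]mulrC mulrACA mulfV// mulr1 mulrC.
Unshelve. all: by end_near. Qed.
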